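(* Let $Q$ be a probability measure on $[0,\infty)$ such that $Q\ll\mathcal U_0^+$, and let $\tilde Q\in\mathcal U_0^+$ be its least concave majorant. Then $Q\ll\tilde Q$, and $\frac{dQ}{d\tilde Q}\in\mathfrak U_1$, where $\frac{dQ}{d\tilde Q}$ is any Radon–Nikodym derivative of $Q$ with respect to $\tilde Q$ such that $\frac{dQ}{d\tilde Q}(x)\in[0,1]$ on $\{x:f_{\tilde Q}(x)=f_Q(x)=0\}$. Consequently, letting $\tilde Q^a$ be the absolutely continuous part of $\tilde Q$ with respect to $Q$: (1) $\tilde Q^a$ is the reverse information projection of $Q$ onto $\mathcal U_0^+$; (2) the ratio $\frac{dQ}{d\tilde Q}=\frac{dQ}{d\tilde Q^a}$ (equality in the $Q$-a.s. sense) is the numeraire (log-optimal) e-value for $\mathcal U_0^+$ under $Q$; (3) for any non-random $n$, $(\tilde Q^a)^n$ is the reverse information projection of $Q^n$ onto $\mathcal U_{0,\mathrm{iid}}^{+n}=\{P^n:P\in\mathcal U_0^+\}$, and the product $M_n=\prod_{i=1}^n\frac{dQ}{d\tilde Q}(X_i)$ forms the log-optimal e-value, nonnegative supermartingale, and e-process for $\mathcal U_0^+$ (i.i.d. observations) under $X_1,\dots,X_n$ i.i.d. from $Q$; additionally, $M_\tau$ is the log-optimal e-value at any finite stopping time $\tau$.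
   Context: $\mathcal U_0^+$ is the set of probability measures on $[0,\infty)$ whose CDF is concave on $[0,\infty)$ (an atom at $0$ allowed). $\mathfrak U_1$ is the set of measurable, locally integrable $E:[0,\infty)\to[0,\infty)$ with $\int_0^xE(t)\,dt\le x$ for all $x\ge 0$ and $E(0)\le1$. $Q\ll\mathcal U_0^+$ means: if $P(A)=0$ for all $P\in\mathcal U_0^+$ then $Q(A)=0$; equivalently $Q(dx)=f_Q(x)\,dx+Q(\{0\})\delta_0(dx)$, i.e. $Q$ is absolutely continuous on $(0,\infty)$ with a possible atom at $0$. The least concave majorant $\tilde Q$ of $Q$ is the probability measure on $[0,\infty)$ whose CDF is the smallest concave function on $[0,\infty)$ majorizing the CDF of $Q$; similarly $\tilde Q(dx)=f_{\tilde Q}(x)\,dx+\tilde Q(\{0\})\delta_0(dx)$. At $x=0$, $f_Q(0)$ and $f_{\tilde Q}(0)$ are read as the atoms $Q(\{0\})$ and $\tilde Q(\{0\})$. For a class $\mathcal A$ of probabilities on a measurable space, $\mathcal A^\circ$ (the e-values for $\mathcal A$) is the set of measurable $[0,\infty)$-valued $f$ with $\sup_{P\in\mathcal A}\int f\,dP\le1$, and ${}^\circ(\mathcal A^\circ)$ is the set of $\sigma$-finite measures $P$ with $\sup_{f\in\mathcal A^\circ}\int f\,dP\le1$. For a probability $R\ll\mathcal A$, the numeraire (log-optimal e-value) is the $R$-a.s. unique, $R$-a.s. positive $E^*\in\mathcal A^\circ$ with $\mathbb E_R\log(E/E^* )\in[-\infty,0]$ for all $E\in\mathcal A^\circ$;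 the reverse information projection (RIPr) of $R$ onto $\mathcal A$ is the measure $P^*$ with $dP^*/dR=1/E^*$; equivalently (Larsson, Ramdas and Ruf) the unique measure in ${}^\circ(\mathcal A^\circ)$ mutually absolutely continuous with $R$ for which some version of $dR/dP^*$ belongs to $\mathcal A^\circ$. In (3): an e-process for $\mathcal U_0^+$ is a nonnegative adapted process $(g_n)$ with $\mathbb E[g_\tau]\le1$ for all (finite) stopping times $\tau$ of the filtration $\sigma(X_1,\dots,X_n)$ when the $X_i$ are i.i.d. from any $P\in\mathcal U_0^+$. Log-optimality at fixed $n$ means $\mathbb E\log(g/M_n)\le0$ under $X_i$ i.i.d. from $Q$ for every e-value $g=g(X_1,\dots,X_n)$ for $\mathcal U_{0,\mathrm{iid}}^{+n}$ (hence every e-process and every nonnegative supermartingale under all i.i.d. laws from $\mathcal U_0^+$ with initial value at most 1); log-optimality at a finite stopping time $\tau$ means $\mathbb E\log(g_\tau/M_\tau)\le0$ under $X_i$ i.i.d. from $Q$ for every e-process $(g_n)$ for $\mathcal U_0^+$. *)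

(* Defs.v *)
From HB Require Import structures.
From mathcomp Require Import all_boot all_order all_algebra.
From mathcomp Require Import all_classical all_reals all_analysis.
Set Implicit Arguments.
Unset Strict Implicit.
Unset Printing Implicit Defensive.
Import Order.TTheory GRing.Theory Num.Theory.
Import numFieldNormedType.Exports.
Local Open Scope classical_set_scope.
Local Open Scope ring_scope.

Section mcons.
Context (d : measure_display) (T : measurableType d) (R : realType) (n : nat).
Local Open Scope ereal_scope.

Definition tcons (p : T * n.-tuple T) : n.+1.-tuple T :=
  [the n.+1.-tuple T of p.1 :: p.2].

Lemma measurable_tcons : measurable_fun [set: T * n.-tuple T] tcons.
Proof. exact: measurable_cons measurable_fst measurable_snd. Qed.

Variables (m : {finite_measure set T -> \bar R})
          (m' : {finite_measure set (n.-tuple T) -> \bar R}).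

Definition mcons : set (n.+1.-tuple T) -> \bar R := pushforward (m \x m') tcons.

Let mcons0 : mcons set0 = 0.
Proof. by rewrite /mcons /pushforward preimage_set0 measure0. Qed.

Let mcons_ge0 A : 0 <= mcons A.
Proof. exact: (measure_ge0 (m \x m')). Qed.

Let mcons_sigma_additive : semi_sigma_additive mcons.
Proof.
move=> F mF tF mUF; rewrite /mcons /pushforward preimage_bigcup.
apply: measure_semi_sigma_additive.
- by move=> n0; rewrite -[X in measurable X]setTI; exact: measurable_tcons.
- apply/trivIsetP => /= i j _ _ ij; rewrite -preimage_setI.
  by move/trivIsetP : tF => /(_ _ _ _ _ ij) ->//; rewrite preimage_set0.
- by rewrite -preimage_bigcup -[X in measurable X]setTI; exact: measurable_tcons.
Qed.

HB.instance Definition _ :=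
  isMeasure.Build _ _ _ mcons mcons0 mcons_ge0 mcons_sigma_additive.

Lemma mcons_setT : mcons setT = m setT * m' setT.
Proof.
by rewrite /mcons /pushforward preimage_setT -setXTT product_measure1E.
Qed.

Let mcons_fin : fin_num_fun mcons.
Proof.
suff : mcons setT < +oo by exact: lty_fin_num_fun.
by rewrite mcons_setT lte_mul_pinfty ?fin_num_measure// ltey_eq fin_num_measure.
Qed.

HB.instance Definition _ := Measure_isFinite.Build _ _ _ mcons mcons_fin.

End mcons.

Section power.
Context (d : measure_display) (T : measurableType d) (R : realType).
Local Open Scope ereal_scope.

Fixpoint mpower (m : {finite_measure set T -> \bar R}) (n : nat) :
    {finite_measure set (n.-tuple T) -> \bar R} :=
  match n with
  | 0%N => [the {finite_measure set (0.-tuple T) -> \bar R} of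
             @dirac _ (0.-tuple T) [tuple] R]
  | n'.+1 => [the {finite_measure set (n'.+1.-tuple T) -> \bar R} of
               mcons m (mpower m n')]
  end.

Definition ppower (P : probability T R) (n : nat) :
  set (n.-tuple T) -> \bar R := mpower P n.
Arguments ppower : clear implicits.

Variables (P : probability T R) (n : nat).

HB.instance Definition _ := Measure.on (ppower P n).

Let ppower_setT : ppower P n setT = 1.
Proof.
rewrite /ppower; elim: n => [|k IH] /=; first by rewrite diracT.
by rewrite mcons_setT IH mule1; exact: probability_setT.
Qed.

HB.instance Definition _ :=
  Measure_isProbability.Build _ _ _ (ppower P n) ppower_setT.

End power.
Arguments ppower {d T R} P n _.

Definition iid_class (d : measure_display) (T : measurableType d)
    (R : realType) (C : set (probability T R)) (n : nat) :
    set (probability (n.-tuple T) R) :=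
  [set ((ppower P n) : probability (n.-tuple T) R) | P in C].
Arguments iid_class {d T R} C n _.

Section comparison.
Context (d : measure_display) (T : measurableType d) (R : realType).
Local Open Scope ereal_scope.

Definition dominated_by_class (Q : probability T R)
    (C : set (probability T R)) : Prop :=
  forall A : set T, measurable A -> (forall P, C P -> P A = 0) -> Q A = 0.

Definition mutually_singular (mu nu : set T -> \bar R) : Prop :=
  exists N : set T, [/\ measurable N, mu N = 0 & nu (~` N) = 0].

Definition is_ac_part (nu mu mua : {measure set T -> \bar R}) : Prop :=
  mua `<< nu /\
  exists mus : {measure set T -> \bar R}, mutually_singular mus nu /\
    forall A : set T, measurable A -> mu A = mua A + mus A.

(* [f] is a (finite, everywhere nonnegative) version of d nu / d mu *)
Definition is_RN_derivative (nu mu : set T -> \bar R) (f : T -> R) : Prop :=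
  [/\ measurable_fun setT f, (forall x, (0 <= f x)%R) &
      forall A : set T, measurable A -> nu A = \int[mu]_(x in A) (f x)%:E].

End comparison.

Section evalues.
Context (d : measure_display) (T : measurableType d) (R : realType).
Local Open Scope ereal_scope.

Definition evalue (C : set (probability T R)) : set (T -> R) :=
  [set f : T -> R | [/\ measurable_fun setT f, (forall x, (0 <= f x)%R) &
              forall P, C P -> \int[P]_x (f x)%:E <= 1]].

(* E_P log(f/g) is in [-oo, 0].  The first conjunct is needed because the
   integral is total, with the convention +oo - +oo = -oo.  [lne 0 = -oo]. *)
Definition Elog_ratio_le0 (P : probability T R) (f g : T -> R) : Prop :=
  let l := fun x => lne (f x / g x)%:E in
  \int[P]_x (l^\+ x) < +oo /\ \int[P]_x l x <= 0.

Definition is_numeraire (C : set (probability T R)) (Q : probability T R)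
    (E : T -> R) : Prop :=
  [/\ evalue C E, {ae Q, forall x, (0 < E x)%R} &
      forall f, evalue C f -> Elog_ratio_le0 Q f E].

(* d P / d Q = 1 / E for the numeraire E of Q *)
Definition is_RIPr (C : set (probability T R)) (Q : probability T R)
    (P : {measure set T -> \bar R}) : Prop :=
  exists E : T -> R,
    is_numeraire C Q E /\ is_RN_derivative P Q (fun x => (E x)^-1)%R.

End evalues.

(** [Omega] carries the observations [X 0, X 1, ...] and one law
    [IP P] for each data-generating distribution [P]; the canonical sequence
    space with its infinite product measures is an instance. *)

Section sequential.
Context (d d' : measure_display) (T : measurableType d)
  (Omega : measurableType d') (R : realType).
Local Open Scope ereal_scope.
Variable X : nat -> {mfun Omega >-> T}.

Definition iid_under (Pr : probability Omega R) (P : probability T R) : Prop :=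
  (forall (i : nat) (A : set T), measurable A -> Pr (X i @^-1` A) = P A) /\
  (forall (s : seq nat) (A : nat -> set T), uniq s ->
     (forall i, measurable (A i)) ->
     Pr (\bigcap_(i in [set` s]) (X i @^-1` A i)) =
     \prod_(i <- s) Pr (X i @^-1` A i)).

(* F_n is generated by the first n observations; F_0 is trivial *)
Definition natural_filtration (n : nat) : set (set Omega) :=
  g_sigma_preimage (fun i : 'I_n => (X i : Omega -> T)).

Definition measurable_wrt (F : set (set Omega)) (f : Omega -> R) : Prop :=
  forall B : set R, measurable B -> F (f @^-1` B).

Definition adapted (g : nat -> Omega -> R) : Prop :=
  forall n, measurable_wrt (natural_filtration n) (g n).

(* [None] stands for the value +oo *)
Definition stopping_time (tau : Omega -> option nat) : Prop :=
  forall n, natural_filtration n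
    [set w | exists2 k, tau w = Some k & (k <= n)%N].

Definition finite_under (Pr : probability Omega R) (tau : Omega -> option nat) :
  Prop := {ae Pr, forall w, tau w <> None}.

(* the value 0 on {tau = +oo} is irrelevant: tau is a.s. finite when used *)
Definition stopped (g : nat -> Omega -> R) (tau : Omega -> option nat)
    (w : Omega) : R :=
  if tau w is Some n then g n w else 0%R.

Definition is_cond_exp (Pr : probability Omega R) (F : set (set Omega))
    (Y Z : Omega -> R) : Prop :=
  [/\ measurable_wrt F Z, Pr.-integrable setT (EFin \o Z) &
      forall A, F A -> \int[Pr]_(w in A) (Z w)%:E = \int[Pr]_(w in A) (Y w)%:E].

Definition supermartingale (Pr : probability Omega R) (g : nat -> Omega -> R) :
    Prop :=
  [/\ adapted g, (forall n, Pr.-integrable setT (EFin \o g n)) &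
      forall n, exists Z, is_cond_exp Pr (natural_filtration n) (g n.+1) Z /\
        {ae Pr, forall w, (Z w <= g n w)%R}].

Variable IP : probability T R -> probability Omega R.

Definition iid_model (C : set (probability T R)) : Prop :=
  forall P, C P -> iid_under (IP P) P.

Definition class_supermartingale (C : set (probability T R))
    (g : nat -> Omega -> R) : Prop :=
  [/\ (forall n w, (0 <= g n w)%R), (forall w, (g 0%N w <= 1)%R) &
      forall P, C P -> supermartingale (IP P) g].

Definition eprocess (C : set (probability T R)) (g : nat -> Omega -> R) : Prop :=
  [/\ (forall n w, (0 <= g n w)%R), adapted g &
      forall P tau, C P -> stopping_time tau -> finite_under (IP P) tau ->
        \int[IP P]_w (stopped g tau w)%:E <= 1].

End sequential.

(** Laws on [0, +oo[ are laws on the real line giving mass 0 to ]-oo, 0[. *)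

Section monotone_densities.
Context (R : realType).
Local Notation law := (probability (measurableTypeR R) R).
Local Notation lambda := (@lebesgue_measure R).

Definition on_halfline (P : law) : Prop := P `]-oo, 0[%classic = 0%E.

Definition CDF (P : law) (x : R) : R := fine (P `]-oo, x]%classic).

Definition concave_on_halfline (F : R -> R) : Prop :=
  forall x y t : R, 0 <= x -> 0 <= y -> 0 <= t <= 1 ->
    t * F x + (1 - t) * F y <= F (t * x + (1 - t) * y).

Definition U0p : set law :=
  [set P | on_halfline P /\ concave_on_halfline (CDF P)].

Definition is_least_concave_majorant (Q Qt : law) : Prop :=
  [/\ U0p Qt, (forall x, 0 <= x -> CDF Q x <= CDF Qt x) &
      forall G : R -> R, concave_on_halfline G ->
        (forall x, 0 <= x -> CDF Q x <= G x) ->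
        forall x, 0 <= x -> CDF Qt x <= G x].

Definition U1 : set (R -> R) :=
  [set E : R -> R | [/\ measurable_fun (`[0, +oo[ : set R) E,
    (forall x, 0 <= x -> 0 <= E x),
    (forall x, 0 <= x -> lambda.-integrable `[0, x] (EFin \o E)),
    (forall x, 0 <= x -> (\int[lambda]_(t in `[0%R, x]) (E t)%:E <= x%:E)%E) &
    E 0 <= 1]].

(* P(dx) = f(x) dx + P({0}) delta_0(dx), where f(0) denotes the atom P({0}) *)
Definition is_density (P : law) (f : R -> R) : Prop :=
  [/\ measurable_fun setT f, (forall x, 0 <= f x),
    (forall A : set R, measurable A ->
       P A = (\int[lambda]_(x in A `&` `]0%R, +oo[) (f x)%:E
              + P [set 0%R] * \d_(0%R : R) A)%E) &
    (f 0)%:E = P [set 0]].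

(* A version of dQ/dQt with values in [0, 1] on {fQt = fQ = 0}.  Two choices of
   the densities differ only on a Lebesgue-null subset of ]0, +oo[. *)
Definition is_dQdQt (Q Qt : law) (E : R -> R) : Prop :=
  is_RN_derivative Q Qt E /\
  exists fQ fQt : R -> R, [/\ is_density Q fQ, is_density Qt fQt &
    forall x, 0 <= x -> fQt x = 0 -> fQ x = 0 -> E x <= 1].

End monotone_densities.
Arguments U0p : clear implicits.
Arguments U1 : clear implicits.

(* Main.v *)
(* The CDF of [Qt] is concave, so [Qt] has a nonincreasing density [g] on
   ]0, +oo[. Tilting the CDF of [Q] by a line of slope [s], its maximum is
   attained at a point where the two CDFs agree, and this point splits
   ]0, +oo[ into [{g >= s}] and [{g <= s}]. Hence [Q] gives at most as much
   mass as [Qt] to [{g < s}] intersected with ]0, x]; integrating over the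
   levels of [1/g] turns this into [int_0^x dQ/dQt <= x], and integrating this
   bound over the levels of a monotone density makes [E = dQ/dQt] an e-value.
   Optimality is [log y <= y - 1]: for an e-value [f],
   [E_Q (f / E) <= E_Qt f <= 1]. The i.i.d. statements follow since the powers
   of [Qa = (1/E) Q] still lie below those of [Qt] on each finite sample. *)
From HB Require Import structures.
Require Import Defs.
From mathcomp Require Import all_boot all_order all_algebra.
From mathcomp Require Import all_classical all_reals all_analysis.
From mathcomp Require Import measurable_realfun.
From mathcomp Require Import ring lra.
Import Order.TTheory GRing.Theory Num.Theory.
Import numFieldNormedType.Exports.
Local Open Scope classical_set_scope.
Local Open Scope ring_scope.
Set Implicit Arguments.
Unset Strict Implicit.
Unset Printing Implicit Defensive.

(** * Layer cake and changes of measure *)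

(** Two obstacles shape the argument. Inside ]0, +oo[ the law [Qt] does not charge [{g = 0}], so
    [dQ/dQt] is arbitrary there, whereas membership in [U1] concerns Lebesgue measure. Hence the
    requirement that a version be at most 1 there, and the splitting [1 = g^-1 * g + 1_{g = 0}]
    under Lebesgue integrals: the first term becomes an integral against [Qt], the second is bounded
    by that requirement. Secondly, [E] may vanish on a set charged by [Qt]. Inverses are total with
    [0^-1 = 0], so [(1/E) Q] is the restriction of [Qt] to [{0 < E}], possibly of mass below 1;
    optimality rests on [Qa <= Qt], the direction in which integrals of e-values stay at most 1. A
    contact point separates [{g >= s}] from [{g <= s}] only up to the level set [{g = s}], which may
    have positive mass; approaching [s] from below avoids it. Absence of atoms off 0 makes the
    tilted CDF continuous up to the jump at 0 and the contact points negligible. *)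

Section layer_cake.
Context d (T : measurableType d) (R : realType).
Local Open Scope ereal_scope.
Local Notation lambda := (@lebesgue_measure R).

Lemma measurable_subgraph (h : T -> R) : measurable_fun setT h ->
  measurable [set p : T * R | p.2 \in `]0%R, h p.1[].
Proof.
move=> mh.
pose f1 (p : T * R) := (0 < p.2)%R.
pose f2 (p : T * R) := (p.2 < h p.1)%R.
rewrite [X in measurable X](_ : _ =
    f1 @^-1` [set true] `&` f2 @^-1` [set true]); last first.
  by apply/seteqP; split => p /=; rewrite in_itv/= => /andP.
apply: measurableI.
- have : measurable_fun setT f1 by exact: measurable_fun_ltr.
  by move=> /(_ measurableT [set true]); rewrite setTI; exact.
- have : measurable_fun setT f2.
    by apply: measurable_fun_ltr => //; exact: measurableT_comp.
  by move=> /(_ measurableT [set true]); rewrite setTI; exact.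
Qed.

Lemma measurable_superlevel (h : T -> R) (s : R) : measurable_fun setT h ->
  measurable [set x | (s < h x)%R].
Proof.
move=> mh; have : measurable_fun setT (fun x => s < h x)%R.
  exact: measurable_fun_ltr.
by move=> /(_ measurableT [set true]); rewrite setTI; exact.
Qed.

Lemma measurable_sublevel (h : T -> R) (s : R) : measurable_fun setT h ->
  measurable [set x | (h x < s)%R].
Proof.
move=> mh; have : measurable_fun setT (fun x => h x < s)%R.
  exact: measurable_fun_ltr.
by move=> /(_ measurableT [set true]); rewrite setTI; exact.
Qed.

Lemma measurable_level0 (h : T -> R) : measurable_fun setT h ->
  measurable [set x | h x = 0%R].
Proof. by move=> mh; have := mh measurableT _ (measurable_set1 0%R); rewrite setTI. Qed.

Context (mu : {sigma_finite_measure set T -> \bar R}).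

(** Tonelli applied to [h x = \int 1_{]0, h x[}(s) ds]. The weight [w] is carried along so that a
    density or an indicator can stay inside the layers; measurability of [F] is returned because
    comparisons integrate two such functions. *)
Lemma layer_cake (h : T -> R) (w : T -> \bar R) :
  measurable_fun setT h -> (forall x, 0 <= h x)%R ->
  measurable_fun setT w -> (forall x, 0 <= w x) ->
  let F := fun s => \int[mu]_x ((\1_(`]0%R, h x[%classic) s)%:E * w x) in
  measurable_fun setT F /\
  \int[mu]_x ((h x)%:E * w x) = \int[lambda]_s F s.
Proof.
move=> mh h0 mw w0 F.
pose f (p : T * R) := ((\1_(`]0%R, h p.1[%classic) p.2)%:E * w p.1).
have f0 p : 0 <= f p by rewrite mule_ge0// lee_fin.
have mf : measurable_fun setT f.
  apply: emeasurable_funM; last exact: measurableT_comp mw measurable_fst.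
  apply/measurable_EFinP.
  rewrite [X in measurable_fun _ X](_ : _ =
      \1_[set p : T * R | p.2 \in `]0%R, h p.1[]); last first.
    by apply/funext => p; rewrite !indicE; congr (_%:R)%R; congr nat_of_bool;
      rewrite !in_setE.
  by apply: measurable_indic; exact: measurable_subgraph.
split; first exact: measurable_fun_fubini_tonelli_G mf f0.
transitivity (\int[mu]_x \int[lambda]_s f (x, s)); last first.
  exact: (@fubini_tonelli _ _ _ _ R mu lambda f mf f0).
apply: eq_integral => x _.
rewrite /f/= ge0_integralZr//.
- rewrite integral_indic//= setIT lebesgue_measure_itv/= lte_fin.
  case: ltgtP (h0 x) => [hx _|//|<- _]; last by rewrite !mul0e.
  by rewrite oppr0 adde0.
- by apply/measurable_EFinP; exact: measurable_indic.
Qed.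

End layer_cake.

Section domination.
Context d1 (T1 : measurableType d1) d2 (T2 : measurableType d2) (R : realType).
Local Open Scope ereal_scope.

(** Layer by layer, a comparison of integrals reduces to one of weighted superlevel sets. The two
    spaces may differ, so an integral over [Omega] can be compared with one over [T]. *)
Lemma layer_cake_le (mu1 : {sigma_finite_measure set T1 -> \bar R})
    (mu2 : {sigma_finite_measure set T2 -> \bar R})
    (h1 : T1 -> R) (h2 : T2 -> R) (w1 : T1 -> \bar R) (w2 : T2 -> \bar R) :
  measurable_fun setT h1 -> (forall x, 0 <= h1 x)%R ->
  measurable_fun setT w1 -> (forall x, 0 <= w1 x) ->
  measurable_fun setT h2 -> (forall x, 0 <= h2 x)%R ->
  measurable_fun setT w2 -> (forall x, 0 <= w2 x) ->
  (forall s, (0 < s)%R ->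
    \int[mu1]_(x in [set x | (s < h1 x)%R]) w1 x <=
    \int[mu2]_(x in [set x | (s < h2 x)%R]) w2 x) ->
  \int[mu1]_x ((h1 x)%:E * w1 x) <= \int[mu2]_x ((h2 x)%:E * w2 x).
Proof.
move=> mh1 h10 mw1 w10 mh2 h20 mw2 w20 le12.
have [mF1 ->] := layer_cake mu1 mh1 h10 mw1 w10.
have [mF2 ->] := layer_cake mu2 mh2 h20 mw2 w20.
have H d (T : measurableType d) (mu : {sigma_finite_measure set T -> \bar R})
    (h : T -> R) (w : T -> \bar R) s : (0 < s)%R ->
    \int[mu]_x ((\1_(`]0%R, h x[%classic) s)%:E * w x) =
    \int[mu]_(x in [set x | (s < h x)%R]) w x.
  move=> s0; rewrite [RHS]integral_mkcond; apply: eq_integral => x _.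
  rewrite patchE indicE; case: (ltP s (h x)) => sh.
    by rewrite !mem_set/= ?in_itv/= ?s0// mul1e.
  by rewrite !memNset/= ?in_itv/= ?s0 ?leNgt/= ?ltNge ?sh// mul0e.
apply: ge0_le_integral => //.
- by move=> s _; apply: integral_ge0 => x _; rewrite mule_ge0// lee_fin.
- move=> s _; have [s0|s0] := ltP 0%R s; first by rewrite !H// le12.
  rewrite !integral0_eq// => x _;
  by rewrite indicE memNset ?mul0e//= in_itv/= ltNge s0.
Qed.

End domination.

Section layer_cake_eq.
Context d1 (T1 : measurableType d1) d2 (T2 : measurableType d2) (R : realType).
Local Open Scope ereal_scope.

Lemma layer_cake_eq (mu1 : {sigma_finite_measure set T1 -> \bar R})
    (mu2 : {sigma_finite_measure set T2 -> \bar R})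
    (h1 : T1 -> R) (h2 : T2 -> R) (w1 : T1 -> \bar R) (w2 : T2 -> \bar R) :
  measurable_fun setT h1 -> (forall x, 0 <= h1 x)%R ->
  measurable_fun setT w1 -> (forall x, 0 <= w1 x) ->
  measurable_fun setT h2 -> (forall x, 0 <= h2 x)%R ->
  measurable_fun setT w2 -> (forall x, 0 <= w2 x) ->
  (forall s, (0 < s)%R ->
    \int[mu1]_(x in [set x | (s < h1 x)%R]) w1 x =
    \int[mu2]_(x in [set x | (s < h2 x)%R]) w2 x) ->
  \int[mu1]_x ((h1 x)%:E * w1 x) = \int[mu2]_x ((h2 x)%:E * w2 x).
Proof.
move=> mh1 h10 mw1 w10 mh2 h20 mw2 w20 eq12.
by apply/eqP; rewrite eq_le; apply/andP; split; apply: layer_cake_le => // s s0;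
  rewrite eq12.
Qed.

End layer_cake_eq.

Section RN.
Context d (T : measurableType d) (R : realType).
Local Open Scope ereal_scope.
Implicit Types nu mu : {sigma_finite_measure set T -> \bar R}.

(** The density relation is only tested on superlevel sets of [f], so it may fail elsewhere: for [f]
    vanishing off ]0, +oo[ a density valid on that interval is enough. *)
Lemma integral_density_superlevel nu mu (h f : T -> R) :
  measurable_fun setT h -> (forall x, 0 <= h x)%R ->
  measurable_fun setT f -> (forall x, 0 <= f x)%R ->
  (forall s, (0 < s)%R -> nu [set x | (s < f x)%R] =
     \int[mu]_(x in [set x | (s < f x)%R]) (h x)%:E) ->
  \int[nu]_x (f x)%:E = \int[mu]_x (f x * h x)%:E.
Proof.
move=> mh h0 mf f0 nuE.
under eq_integral do rewrite -[(f _)%:E]mule1.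
under [RHS]eq_integral do rewrite EFinM.
have H s : (0 < s)%R -> \int[nu]_(x in [set x | (s < f x)%R]) 1 =
           \int[mu]_(x in [set x | (s < f x)%R]) (h x)%:E.
  move=> s0; have mS := measurable_superlevel s mf.
  by rewrite integral_cst// mul1e; exact: nuE.
apply/eqP; rewrite eq_le; apply/andP; split; apply: layer_cake_le => //;
  by [exact/measurable_EFinP| move=> *; rewrite lee_fin | move=> s s0; rewrite H].
Qed.

Lemma RN_change_of_variables nu mu (h f : T -> R) :
  is_RN_derivative nu mu h -> measurable_fun setT f -> (forall x, 0 <= f x)%R ->
  \int[nu]_x (f x)%:E = \int[mu]_x (f x * h x)%:E.
Proof.
move=> [mh h0 nuE] mf f0; apply: integral_density_superlevel => // s s0.
by apply: nuE; exact: measurable_superlevel.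
Qed.

Lemma RN_change_of_variables_set nu mu (h f : T -> R) (A : set T) :
  is_RN_derivative nu mu h -> measurable_fun setT f -> (forall x, 0 <= f x)%R ->
  measurable A ->
  \int[nu]_(x in A) (f x)%:E = \int[mu]_(x in A) (f x * h x)%:E.
Proof.
move=> RN mf f0 mA; rewrite integral_mkcond [RHS]integral_mkcond.
transitivity (\int[nu]_x ((\1_A x * f x)%R)%:E).
  by apply: eq_integral => x _; rewrite patchE indicE; case: ifPn;
    rewrite ?mul1r ?mul0r.
rewrite (RN_change_of_variables RN)//.
- by apply: eq_integral => x _; rewrite patchE indicE; case: ifPn;
  rewrite ?mul1r ?mul0r.
- by apply: measurable_funM => //; exact: measurable_indic.
- by move=> x; rewrite mulr_ge0.
Qed.

End RN.

(** * Numeraires from likelihood ratios *)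

Lemma measurable_invr (R : realType) : measurable_fun setT (@GRing.inv R).
Proof.
have -> : [set: R] = [set x | x != 0] `|` [set 0].
  by apply/seteqP; split => x //= _; have [->|] := eqVneq x 0; [right|left].
have oN0 : open [set x : R | x != 0] by exact: open_neq.
apply/measurable_funU => //; first exact: open_measurable.
split; last exact: measurable_fun_set1.
apply: open_continuous_measurable_fun => // x; rewrite inE/= => x0.
exact: inv_continuous.
Qed.

Lemma measurable_funV d (T : measurableType d) (R : realType) (f : T -> R) :
  measurable_fun setT f -> measurable_fun setT (fun x => (f x)^-1).
Proof. by move=> mf; exact: measurableT_comp (@measurable_invr R) mf. Qed.

Section log_bound.
Context d (T : measurableType d) (R : realType).
Local Open Scope ereal_scope.

Lemma measurable_lne_EFin (r : T -> R) : measurable_fun setT r ->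
  measurable_fun setT (fun x => lne (r x)%:E).
Proof.
move=> mr.
rewrite (_ : (fun _ => _) =
    fun x => if (r x <= 0)%R then -oo else (ln (r x))%:E); last first.
  apply/funext => x; case: ifPn => [r0|]; first by rewrite le0_lneNy// lee_fin.
  by rewrite -ltNge => r0; rewrite lne_EFin.
apply: measurable_fun_ifT => //; first exact: measurable_fun_ler.
by apply/measurable_EFinP; exact: measurableT_comp.
Qed.

(* Integrates [(log r)^+ + 1 <= r + (log r)^-], that is [log r <= r - 1]. *)
Lemma Elog_ratio_le0_of_integral_le1 (P : probability T R) (f g : T -> R) :
  measurable_fun setT f -> measurable_fun setT g ->
  (forall x, 0 <= f x)%R -> (forall x, 0 <= g x)%R ->
  \int[P]_x (f x / g x)%:E <= 1 -> Elog_ratio_le0 P f g.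
Proof.
move=> mf mg f0 g0 fg1.
have r0 x : (0 <= f x / g x)%R by rewrite divr_ge0.
have mr : measurable_fun setT (fun x => f x / g x)%R.
  by apply: measurable_funM => //; exact: measurable_funV.
have ml := measurable_lne_EFin mr.
set l := fun x => lne (f x / g x)%:E in ml.
have lr x : l^\+ x <= (f x / g x)%:E.
  rewrite funeposE ge_max lee_fin r0 andbT /l.
  by apply/ltW/lne_sublinear.
have lr1 x : l^\+ x + 1 <= (f x / g x)%:E + l^\- x.
  rewrite funeposE funenegE /l.
  have := r0 x; rewrite le_eqVlt => /predU1P[<-|rgt0].
    by rewrite le0_lneNy//= maxNye maxye addey// leey.
  rewrite lne_EFin// -EFinN /maxe !lte_fin.
  have H : (ln (f x / g x) <= f x / g x - 1)%R.
    rewrite -[X in ln X](subrK 1%R) addrC; apply: le_ln1Dx; lra.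
  by case: ltP => ?; case: ltP => ?; rewrite -?EFinD lee_fin; lra.
have lp1 : \int[P]_x l^\+ x <= 1.
  apply: le_trans fg1; apply: ge0_le_integral => //.
  - exact: measurable_funepos.
  - by apply/measurable_EFinP.
split; rewrite -/l; first by rewrite (le_lt_trans lp1)// ltry.
rewrite integralE sube_le0.
have : \int[P]_x l^\+ x + 1 <= 1 + \int[P]_x l^\- x.
  have -> : \int[P]_x l^\+ x + 1 = \int[P]_x (l^\+ x + 1).
    rewrite ge0_integralD//; last exact: measurable_funepos.
    by rewrite integral_cst// mul1e; congr (_ + _); exact/esym/probability_setT.
  apply: (@le_trans _ _ (\int[P]_x ((f x / g x)%:E + l^\- x))).
    apply: ge0_le_integral => //.
    - by move=> x _; rewrite adde_ge0.
    - by apply: emeasurable_funD => //; exact: measurable_funepos.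
    - by apply: emeasurable_funD; [exact/measurable_EFinP|exact: measurable_funeneg].
  rewrite ge0_integralD//;
    [|by move=> x _; rewrite lee_fin|exact/measurable_EFinP|exact: measurable_funeneg].
  by rewrite leeD.
by rewrite addeC leeD2lE.
Qed.

End log_bound.

Section numeraire.
Context d (T : measurableType d) (R : realType).
Local Open Scope ereal_scope.

(** The expectation of [f / E] under [Q] is the integral of [f] against [P], hence at most 1, and
    the logarithmic bound applies. [P] may lie outside [C] and have mass below 1: only its integrals
    of e-values matter, that is, membership in the bipolar of [C]. *)
Lemma is_numeraire_of_RN (C : set (probability T R)) (Q : probability T R)
    (P : {finite_measure set T -> \bar R}) (E : T -> R) :
  evalue C E -> {ae Q, forall x, (0 < E x)%R} ->
  is_RN_derivative P Q (fun x => (E x)^-1)%R ->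
  (forall f, evalue C f -> \int[P]_x (f x)%:E <= 1) ->
  is_numeraire C Q E.
Proof.
move=> CE Epos PQ Pf; split => // f Cf; have [mf f0 _] := Cf; have [mE E0 _] := CE.
apply: Elog_ratio_le0_of_integral_le1 => //.
by rewrite -(RN_change_of_variables PQ)//; exact: Pf.
Qed.

Lemma RN_pos_ae (Q P : {finite_measure set T -> \bar R}) (E : T -> R) :
  is_RN_derivative Q P E -> {ae Q, forall x, (0 < E x)%R}.
Proof.
move=> [mE E0 QE]; exists [set x | E x = 0%R].
have mZ := measurable_level0 mE.
split => //.
  by rewrite QE//; apply: integral0_eq => x /= ->.
by move=> x /= /negP; rewrite -leNgt => Ex; apply/eqP; rewrite eq_le Ex E0.
Qed.

Lemma measure_eq0_of_integral (P : {measure set T -> \bar R}) (f : T -> R)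
    (B : set T) : measurable B -> measurable_fun setT f ->
  (forall x, B x -> 0 < f x)%R -> \int[P]_(x in B) (f x)%:E = 0 -> P B = 0.
Proof.
move=> mB mf f0 fB0.
have mfB : measurable_fun B (EFin \o f).
  by apply/measurable_EFinP; exact: measurable_funTS.
have /(ae_eq_integral_abs P mB mfB)[N [mN PN BN]] :
    \int[P]_(x in B) `|(EFin \o f) x| = 0.
  by rewrite -[RHS]fB0; apply: eq_integral => x /[!inE] /f0 fx0; rewrite /= gtr0_norm.
apply: subset_measure0 PN => // x Bx; apply: BN => /= /(_ Bx)[].
by have := f0 _ Bx => /[swap] ->; rewrite ltxx.
Qed.

Lemma ac_part_integral_le (nu mu mua : {measure set T -> \bar R}) (f : T -> R) :
  is_ac_part nu mu mua -> measurable_fun setT f ->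
  (forall x, 0 <= f x)%R -> \int[mua]_x (f x)%:E <= \int[mu]_x (f x)%:E.
Proof.
move=> [_ [mus [_ H]]] mf f0; apply: ge0_le_measure_integral => //;
  last exact/measurable_EFinP.
by move=> A mA; rewrite H// leeDl.
Qed.

Section ac_part.
Variables (Q P : {finite_measure set T -> \bar R}) (E : T -> R).
Variable Pa : {finite_measure set T -> \bar R}.
Hypothesis QE : is_RN_derivative Q P E.
Hypothesis PaP : is_ac_part Q P Pa.

(** Identifies any Lebesgue decomposition with the one cut at [{0 < E}]. The singular part lives off
    [N], where [Q] vanishes; a positive density then makes [P] null on [{0 < E}] minus [N].
    Conversely [Q], hence [Pa], does not charge [{E = 0}]. *)
Lemma ac_part_indic : is_RN_derivative Pa P \1_[set x | (0 < E x)%R].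
Proof.
have [mE E0 QA] := QE.
have mD : measurable [set x | (0 < E x)%R] by exact: measurable_superlevel.
move: PaP => [PaQ [mus [[N [mN musN QN]] H]]]; split => // A mA.
have mus_le B : measurable B -> mus B <= P B by move=> mB; rewrite H// leeDr.
rewrite integral_indic//; set D := [set x | _] in mD *.
have mDN : measurable (D `\` N) by exact: measurableD.
have musD : mus D = 0.
  have musDN : mus (D `&` N) = 0.
    by apply: subset_measure0 musN => //; exact: measurableI.
  have -> : mus D = mus (D `\` N) + mus (D `&` N) by exact: measureDI.
  rewrite musDN adde0; apply/eqP; rewrite -measure_le0 (le_trans (mus_le _ mDN))//.
  rewrite (@measure_eq0_of_integral P E)//; first by move=> x [].
  rewrite -QA//; apply: subset_measure0 QN => //; exact: measurableC.
have PaDC : Pa (~` D) = 0.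
  apply: ((null_content_dominatesP _ _).1 PaQ); first exact: measurableC.
  transitivity (\int[P]_(x in ~` D) (E x)%:E); first by apply: QA; exact: measurableC.
  apply: integral0_eq => x /=; rewrite /D/= => /negP; rewrite -leNgt => Ex.
  by congr EFin; apply/eqP; rewrite eq_le Ex E0.
have mAD : measurable (D `&` A) by exact: measurableI.
have musAD : mus (D `&` A) = 0.
  by apply: subset_measure0 musD => //; exact: subIsetl.
have PaAD : Pa (A `\` D) = 0.
  apply: subset_measure0 PaDC; [exact: measurableD|exact: measurableC|].
  by move=> x [].
have -> : Pa A = Pa (A `\` D) + Pa (A `&` D) by exact: measureDI.
by rewrite H// musAD adde0 PaAD add0e setIC.
Qed.

(** With [0^-1 = 0] the product of [E^-1] and [E] is the indicator of [{0 < E}], so [1/E] is a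
    version everywhere and no exceptional set appears. *)
Lemma ac_part_inv : is_RN_derivative Pa Q (fun x => (E x)^-1)%R.
Proof.
have [mE E0 _] := QE; have [mD _ PaE] := ac_part_indic.
have mEV : measurable_fun setT (fun x => (E x)^-1)%R by exact: measurable_funV.
split => [//|x|A mA]; first by rewrite invr_ge0.
rewrite (RN_change_of_variables_set QE)//; last by move=> x; rewrite invr_ge0.
rewrite PaE//; apply: eq_integral => x _; congr EFin; rewrite indicE.
have := E0 x; rewrite le_eqVlt => /predU1P[Ex|Ex].
  by rewrite -Ex mulr0 memNset//= -Ex ltxx.
by rewrite mulVf ?gt_eqF// mem_set.
Qed.

Lemma ac_part_RN : is_RN_derivative Q Pa E.
Proof.
have [mE E0 QA] := QE; split => // A mA.
rewrite (RN_change_of_variables_set ac_part_indic)// QA//.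
apply: eq_integral => x _; congr EFin; rewrite indicE.
have := E0 x; rewrite le_eqVlt => /predU1P[<-|Ex]; first by rewrite mul0r.
by rewrite mem_set// mulr1.
Qed.

End ac_part.

Lemma RN_unique (Q P : {finite_measure set T -> \bar R}) (E E' : T -> R) :
  is_RN_derivative Q P E -> is_RN_derivative Q P E' ->
  {ae Q, forall x, E x = E' x}.
Proof.
move=> [mE E0 QE] [mE' E'0 QE'].
have iE : P.-integrable setT (EFin \o E).
  apply/integrableP; split; first exact/measurable_EFinP.
  under eq_integral do rewrite /= ger0_norm//.
  by rewrite -QE// ltey_eq fin_num_measure.
have : ae_eq P setT (EFin \o E) (EFin \o E').
  apply: integral_ae_eq => //; first exact/measurable_EFinP.
  by move=> A _ mA; rewrite -QE// -QE'.
move=> [N [mN PN sub]]; exists N; split => //.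
  by rewrite QE//; apply: null_set_integral => //; apply/measurable_EFinP;
    exact: measurable_funTS.
by move=> x /= EE'; apply: sub => /= /(_ I)[].
Qed.

End numeraire.

(** * Powers of measures *)

Section mpower_integral.
Context d (T : measurableType d) (R : realType).
Local Open Scope ereal_scope.
Implicit Types m nu mu : {finite_measure set T -> \bar R}.

Lemma measurable_tcons_fun n (f : n.+1.-tuple T -> \bar R) :
  measurable_fun setT f ->
  measurable_fun setT (fun p : T * n.-tuple T => f (tcons p)).
Proof. by move=> mf; exact: measurableT_comp mf (@measurable_tcons _ _ _). Qed.

Lemma ge0_integral_mpowerS m n (f : n.+1.-tuple T -> \bar R) :
  measurable_fun setT f -> (forall x, 0 <= f x) ->
  \int[mpower m n.+1]_z f z = \int[m]_x \int[mpower m n]_y f (tcons (x, y)).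
Proof.
move=> mf f0.
transitivity (\int[m \x mpower m n]_p f (tcons p)).
  by rewrite [LHS](ge0_integral_pushforward (@measurable_tcons _ _ _)).
exact: (fubini_tonelli1 _ (measurable_tcons_fun mf)).
Qed.

Lemma measurable_prod_tnth (h : T -> R) n : measurable_fun setT h ->
  measurable_fun setT (fun x : n.-tuple T => \prod_(i < n) h (tnth x i))%R.
Proof.
move=> mh; apply: measurable_prod => i _.
exact: measurableT_comp mh (measurable_tnth i).
Qed.

Lemma prod_tnth_tcons (h : T -> R) n (x : T) (y : n.-tuple T) :
  (\prod_(i < n.+1) h (tnth (tcons (x, y)) i) =
   h x * \prod_(i < n) h (tnth y i))%R.
Proof.
rewrite big_ord_recl; congr (h _ * _)%R.
by apply: eq_bigr => i _; rewrite tnthS.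
Qed.

(** Induction on the sample size: Tonelli separates the first coordinate, the induction hypothesis
    changes the measure within each section of [A], and [RN] changes it in the outer integral. *)
Lemma is_RN_derivative_mpower nu mu (h : T -> R) n :
  is_RN_derivative nu mu h ->
  is_RN_derivative (mpower nu n) (mpower mu n)
    (fun x : n.-tuple T => \prod_(i < n) h (tnth x i))%R.
Proof.
move=> RN; have [mh h0 _] := RN; elim: n => [|n IH].
  split => [|x|A mA]; first exact: measurable_prod_tnth.
    by rewrite big_ord0.
  under eq_integral do rewrite big_ord0.
  by rewrite integral_cst// mul1e.
have mH k := measurable_prod_tnth (n := k) mh.
have H0 k (x : k.-tuple T) : (0 <= \prod_(i < k) h (tnth x i))%R by exact: prodr_ge0.
split => [|x|A mA]; [exact: mH|exact: H0|].
rewrite [RHS]integral_mkcond.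
transitivity (\int[mpower nu n.+1]_z (\1_A z)%:E).
  by rewrite integral_indic// setIT.
transitivity (\int[mpower mu n.+1]_z (\1_A z * \prod_(i < n.+1) h (tnth z i))%:E);
  last first.
  by apply: eq_integral => x _; rewrite patchE indicE; case: ifPn;
    rewrite ?mul1r ?mul0r.
have mA1 : measurable_fun setT (\1_A : n.+1.-tuple T -> R) by exact: measurable_indic.
have mAc : measurable_fun setT (fun p : T * n.-tuple T => \1_A (tcons p) : R).
  exact: measurableT_comp mA1 (@measurable_tcons _ _ _).
rewrite ge0_integral_mpowerS//; last exact/measurable_EFinP.
rewrite ge0_integral_mpowerS//; last 2 first.
  by apply/measurable_EFinP; exact: measurable_funM mA1 (mH n.+1).
  by move=> x; rewrite lee_fin mulr_ge0.
pose G x := \int[mpower nu n]_y (\1_A (tcons (x, y)))%:E.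
have mAx x : measurable_fun setT (fun y : n.-tuple T => \1_A (tcons (x, y)) : R).
  exact: measurableT_comp mAc (measurable_pair1 x).
have G0 x : 0 <= G x by apply: integral_ge0 => y _; rewrite lee_fin.
(* [RN_change_of_variables] takes real-valued functions, so the section measure [G] must be finite
   before it passes through [fine]. *)
have Gfin x : G x \is a fin_num.
  rewrite ge0_fin_numE//; apply: (@le_lt_trans _ _ (\int[mpower nu n]_y 1)).
    apply: ge0_le_integral => //; first exact/measurable_EFinP.
    by move=> y _; rewrite lee_fin indicE; case: (_ \in _).
  by rewrite integral_cst// mul1e ltey_eq fin_num_measure.
have mG : measurable_fun setT G.
  apply: (@measurable_fun_fubini_tonelli_F _ _ _ _ _ (mpower nu n)
    (fun p : T * n.-tuple T => (\1_A (tcons p))%:E)).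
    exact/measurable_EFinP.
  by move=> p; rewrite lee_fin.
transitivity (\int[nu]_x (fine (G x))%:E).
  by apply: eq_integral => x _; rewrite fineK.
rewrite (RN_change_of_variables RN).
- apply: eq_integral => x _; rewrite EFinM fineK// /G.
  rewrite (RN_change_of_variables IH)// -ge0_integralZr//.
  + by apply: eq_integral => y _; rewrite prod_tnth_tcons -EFinM; congr EFin; ring.
  + by apply/measurable_EFinP; exact: measurable_funM (mAx x) (mH n).
  + by move=> y _; rewrite lee_fin mulr_ge0.
  + by rewrite lee_fin.
- exact: measurableT_comp mG.
- by move=> x; rewrite fine_ge0.
Qed.

Lemma integral_prod_mpower_le1 m (h : T -> R) n :
  measurable_fun setT h -> (forall x, 0 <= h x)%R ->
  \int[m]_x (h x)%:E <= 1 ->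
  \int[mpower m n]_x (\prod_(i < n) h (tnth x i))%:E <= 1.
Proof.
move=> mh h0 h1; elim: n => [|n IH].
  under eq_integral do rewrite big_ord0.
  by rewrite integral_cst//= mul1e diracT.
have mH k := measurable_prod_tnth (n := k) mh.
have H0 k (x : k.-tuple T) : (0 <= \prod_(i < k) h (tnth x i))%R by exact: prodr_ge0.
rewrite ge0_integral_mpowerS//; last 2 first.
- by apply/measurable_EFinP; exact: mH.
- by move=> x; rewrite lee_fin.
apply: le_trans h1; apply: ge0_le_integral => //.
- by move=> x _; apply: integral_ge0 => y _; rewrite lee_fin.
- apply: (@measurable_fun_fubini_tonelli_F _ _ _ _ _ (mpower m n)
    (fun p : T * n.-tuple T => (\prod_(i < n.+1) h (tnth (tcons p) i))%:E)).
    apply: (measurable_tcons_fun (f := fun z =>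
      (\prod_(i < n.+1) h (tnth z i))%:E)).
    by apply/measurable_EFinP; exact: mH.
  by move=> p; rewrite lee_fin.
- exact/measurable_EFinP.
- move=> x _; under eq_integral do rewrite prod_tnth_tcons EFinM.
  rewrite ge0_integralZl//; last 3 first.
    by apply/measurable_EFinP; exact: mH.
    by move=> y _; rewrite lee_fin.
    by rewrite lee_fin.
  by rewrite -[leRHS]mule1 lee_wpmul2l// lee_fin.
Qed.

End mpower_integral.

(** * Concave distribution functions *)

Section right_slope.
Context (R : realType) (F : R -> R).
Hypothesis F_concave : concave_on_halfline F.
Hypothesis F_nd : forall x y, x <= y -> F x <= F y.

Lemma concave_chord a b c : 0 <= a -> a < b -> b < c ->
  (F c - F b) / (c - b) <= (F b - F a) / (b - a).
Proof.
move=> a0 ab bc.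
rewrite ler_pdivrMr ?subr_gt0// mulrAC ler_pdivlMr ?subr_gt0//.
have ca : 0 < c - a by lra.
pose t := (c - b) / (c - a).
have t01 : 0 <= t <= 1.
  apply/andP; split; first by apply: divr_ge0; lra.
  by rewrite /t ler_pdivrMr// mul1r; lra.
have tca : t * (c - a) = c - b by rewrite divfK// gt_eqF.
have := F_concave a0 (_ : 0 <= c) t01 => /(_ ltac:(lra)).
have -> : t * a + (1 - t) * c = b.
  rewrite -[RHS](subKr c) -tca; ring.
move=> H; have := ler_wpM2r (ltW ca) H.
rewrite (_ : (t * F a + (1 - t) * F c) * (c - a) =
  t * (c - a) * F a + (c - a - t * (c - a)) * F c); last by ring.
rewrite tca => {}H; nra.
Qed.

(** The right derivative of a concave function, taken as a supremum of chord slopes so that no limit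
    is involved. The value 0 for [t <= 0] lets it serve as a density on ]0, +oo[ extended by
    zero. *)
Definition right_slope t : R :=
  if 0 < t then sup [set (F y - F t) / (y - t) | y in `]t, +oo[%classic] else 0.

Lemma has_sup_right_slope t : 0 < t ->
  has_sup [set (F y - F t) / (y - t) | y in `]t, +oo[%classic].
Proof.
move=> t0; split.
  by exists ((F (t + 1) - F t) / (t + 1 - t)), (t + 1) => //=; rewrite in_itv/=; lra.
exists ((F t - F 0) / (t - 0)) => _ /= [y + <-]; rewrite in_itv/= andbT => ty.
exact: concave_chord.
Qed.

Lemma le_right_slope t y : 0 < t -> t < y -> (F y - F t) / (y - t) <= right_slope t.
Proof.
move=> t0 ty; rewrite /right_slope t0; apply: sup_upper_bound.
  exact: has_sup_right_slope.
by exists y => //=; rewrite in_itv/= ty.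
Qed.

Lemma right_slope_le t y : 0 <= t -> t < y -> right_slope y <= (F y - F t) / (y - t).
Proof.
move=> t0 ty; have y0 : 0 < y by lra.
rewrite /right_slope y0; apply: ge_sup; first by have [] := has_sup_right_slope y0.
by move=> _ /= [z + <-]; rewrite in_itv/= andbT => yz; exact: concave_chord.
Qed.

Lemma right_slope_ge0 t : 0 <= right_slope t.
Proof.
have [t0|t0] := ltP 0 t; last by rewrite /right_slope (ltNge 0 t) t0.
apply: le_trans (le_right_slope t0 (_ : t < t + 1)); last by lra.
by rewrite divr_ge0 ?subr_ge0 ?F_nd//; lra.
Qed.

Lemma right_slope_ni t y : 0 < t -> t <= y -> right_slope y <= right_slope t.
Proof.
move=> t0; rewrite le_eqVlt => /predU1P[->//|ty].
by rewrite (le_trans (right_slope_le (ltW t0) ty))// le_right_slope.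
Qed.

End right_slope.

(** * The density of a law with concave distribution function *)

Section density_measure.
Context d (T : measurableType d) (R : realType) (mu : {measure set T -> \bar R}).
Variables (f : T -> R) (mf : measurable_fun setT f) (f0 : forall x, 0 <= f x).
Local Open Scope ereal_scope.

(** The two proofs are arguments so that the measure structure can be inferred from the term
    itself. *)
Definition density_measure & measurable_fun setT f & (forall x, 0 <= f x)%R :=
  fun A : set T => \int[mu]_(x in A) (f x)%:E.
Local Notation nu := (density_measure mf f0).

Let nu0 : nu set0 = 0. Proof. exact: integral_set0. Qed.

Let nu_ge0 A : 0 <= nu A.
Proof. by apply: integral_ge0 => x _; rewrite lee_fin. Qed.

Let nu_sigma_additive : semi_sigma_additive nu.
Proof.
move=> F mF tF mUF; rewrite /nu ge0_integral_bigcup//; last 2 first.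
- by apply/measurable_EFinP; exact: measurable_funTS.
- by move=> x _; rewrite lee_fin.
apply: is_cvg_nneseries => n _ _; exact: nu_ge0.
Qed.

HB.instance Definition _ :=
  isMeasure.Build _ _ _ nu nu0 nu_ge0 nu_sigma_additive.

End density_measure.

(** The integral ranges over all of [A] because [g] vanishes outside ]0, +oo[; the atom at 0 is
    thereby kept apart. *)
Definition monotone_density (R : realType)
    (P : probability (measurableTypeR R) R) (g : R -> R) :=
  [/\ measurable_fun setT g, (forall x, 0 <= g x), (forall x, x <= 0 -> g x = 0),
    (forall x y, 0 < x -> x <= y -> g y <= g x) &
    forall A : set R, measurable A ->
      P (A `&` `]0, +oo[) = (\int[@lebesgue_measure R]_(x in A) (g x)%:E)%E].

Section CDF_facts.
Context (R : realType) (P : probability (measurableTypeR R) R).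

Lemma CDF_fin x : (CDF P x)%:E = P `]-oo, x]%classic.
Proof. by rewrite fineK// fin_num_measure. Qed.

Lemma CDF_nd x y : x <= y -> CDF P x <= CDF P y.
Proof.
move=> xy; rewrite -lee_fin !CDF_fin le_measure ?inE//.
exact: subset_itvl.
Qed.

Lemma CDF_ge0 x : 0 <= CDF P x.
Proof. by rewrite -lee_fin CDF_fin. Qed.

Lemma CDF_le1 x : CDF P x <= 1.
Proof. by rewrite -lee_fin CDF_fin probability_le1. Qed.

Lemma CDF_itvoc x y : x <= y -> P `]x, y]%classic = (CDF P y - CDF P x)%:E.
Proof.
move=> xy; rewrite EFinB !CDF_fin.
have -> : `]-oo, y]%classic = `]-oo, x] `|` `]x, y] :> set R.
  apply/seteqP; split => z /=; rewrite !in_itv/=.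
    by move=> zy; case: (leP z x) => zx; [left|right].
  by case=> [zx|/andP[]//]; rewrite (le_trans zx).
rewrite measureU//; last first.
  apply/seteqP; split => z //=; rewrite !in_itv/= => -[zx /andP[xz _]].
  by move: xz; rewrite ltNge zx.
by rewrite addeAC subee ?fin_num_measure// add0e.
Qed.

End CDF_facts.

Section density.
Context (R : realType) (P : probability (measurableTypeR R) R).
Hypothesis P_concave : concave_on_halfline (CDF P).
Local Notation F := (CDF P).
Local Notation g := (right_slope (CDF P)).
Local Notation lambda := (@lebesgue_measure R).

(** Superlevel sets are intervals: the whole line for a negative level, otherwise a part of ]0,
    +oo[, where the slope is nonincreasing. *)
Lemma measurable_right_slope : measurable_fun setT g.
Proof.
apply: (measurability (@RGenOInfty.G R)) => [|/= _ [_] [r] -> <-].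
  exact: RGenOInfty.measurableE.
rewrite setTI; apply: is_interval_measurable => s t /=.
rewrite !in_itv/= !andbT => gs gt u /andP[su ut]; rewrite in_itv/= andbT.
have [r0|r0] := ltP r 0; first by rewrite (lt_le_trans r0)// right_slope_ge0//;
  exact: CDF_nd.
have s0 : 0 < s.
  by rewrite ltNge; apply/negP => s0; move: gs;
    rewrite /right_slope (ltNge 0 s) s0/= ltNge r0.
apply: lt_le_trans gt _; apply: right_slope_ni => //.
exact: lt_le_trans s0 su.
Qed.
Let mg := measurable_right_slope.
Let g0 : forall x, 0 <= g x := right_slope_ge0 P_concave (@CDF_nd R P).
Let g_ni x y : 0 < x -> x <= y -> g y <= g x.
Proof. exact: right_slope_ni. Qed.

Let I x y := (\int[lambda]_(t in `]x, y]) (g t)%:E)%E.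

Let I_bounds x y : 0 < x -> x <= y ->
  (((y - x) * g y)%:E <= I x y <= ((y - x) * g x)%:E)%E.
Proof.
move=> x0 xy.
have cstE c : (\int[lambda]_(t in `]x, y]) c%:E = ((y - x) * c)%:E)%E.
  rewrite integral_cst//= lebesgue_measure_itv/= lte_fin.
  case: ltgtP xy => // [xy _|-> _]; first by rewrite muleC -EFinB -EFinM.
  by rewrite mule0 subrr mul0r.
have mgI : measurable_fun `]x, y] (EFin \o g).
  by apply/measurable_EFinP; exact: measurable_funTS.
apply/andP; split; rewrite -cstE; apply: ge0_le_integral => //;
  do ?[by move=> t _; rewrite lee_fin].
- move=> t /=; rewrite in_itv/= => /andP[xt ty]; rewrite lee_fin g_ni//.
  exact: lt_trans x0 xt.
- by move=> t /=; rewrite in_itv/= => /andP[xt ty]; rewrite lee_fin g_ni// ltW.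
Qed.

Let I_fin x y : 0 < x -> x <= y -> I x y \is a fin_num.
Proof.
move=> x0 xy; have /andP[l u] := I_bounds x0 xy.
by rewrite fin_real// (lt_le_trans (ltNyr _) l)/= (le_lt_trans u)// ltry.
Qed.

(** The defect in the fundamental theorem of calculus for [F] and [g]. It is additive over adjacent
    intervals, and since both the increment of [F] and the integral of [g] lie between
    [(y - x) * g y] and [(y - x) * g x], it is at most [(y - x) * (g x - g y)]. *)
Let D x y := F y - F x - fine (I x y).

Let D_split x m y : 0 < x -> x <= m -> m <= y -> D x y = D x m + D m y.
Proof.
move=> x0 xm my; have m0 := lt_le_trans x0 xm.
have -> : D x y = F y - F x - (fine (I x m) + fine (I m y)).
  congr (_ - _); rewrite -fineD ?I_fin//; congr fine.
  rewrite /I -ge0_integral_setU//=.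
  - congr (integral _ _ _); apply/seteqP; split => t /=; rewrite !in_itv/=.
      by move=> /andP[xt ty]; case: (leP t m) => tm; [left|right]; rewrite ?xt ?ty.
    case=> /andP[t1 t2]; first by rewrite t1 (le_trans t2).
    by rewrite t2 (le_lt_trans xm).
  - by apply/measurable_EFinP; exact: measurable_funTS.
  - by move=> t _; rewrite lee_fin.
  - rewrite disj_set2E; apply/eqP/seteqP; split => t //=; rewrite !in_itv/=.
    by move=> [/andP[_ tm] /andP[mt _]]; move: mt; rewrite ltNge tm.
rewrite /D; ring.
Qed.

Let D_bound x y : 0 < x -> x <= y -> `|D x y| <= (y - x) * (g x - g y).
Proof.
move=> x0 xy; have := I_bounds x0 xy; rewrite -(fineK (I_fin x0 xy)) !lee_fin.
move: xy; rewrite le_eqVlt => /predU1P[<-|xy].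
  by rewrite subrr !mul0r /D subrr => ?; rewrite ler_norml; lra.
have h1 := right_slope_le P_concave (ltW x0) xy.
have h2 := le_right_slope P_concave x0 xy.
move: h1 h2; rewrite ler_pdivlMr ?subr_gt0// ler_pdivrMr ?subr_gt0// => h1 h2.
by move=> /andP[h3 h4]; rewrite ler_norml /D; apply/andP; split; lra.
Qed.

(** Bisection gains a factor 2 each time: both halves have half the length, while the drops of [g]
    over them add up to the drop over the whole interval. *)
Let D_bisect n x y : 0 < x -> x <= y ->
  `|D x y| * 2 ^+ n <= (y - x) * (g x - g y).
Proof.
elim: n x y => [|n IH] x y x0 xy; first by rewrite expr0 mulr1 D_bound.
pose m := (x + y) / 2.
have xm : x <= m by rewrite /m; lra.
have my : m <= y by rewrite /m; lra.
have m0 := lt_le_trans x0 xm.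
rewrite (D_split x0 xm my) exprS.
have h1 := IH _ _ x0 xm; have h2 := IH _ _ m0 my.
have e1 : m - x = (y - x) / 2 by rewrite /m; lra.
have e2 : y - m = (y - x) / 2 by rewrite /m; lra.
rewrite e1 in h1; rewrite e2 in h2.
have h3 : `|D x m + D m y| * 2 ^+ n <= (`|D x m| + `|D m y|) * 2 ^+ n.
  by rewrite ler_wpM2r ?exprn_ge0// ler_normD.
lra.
Qed.

Lemma CDF_integral_right_slope x y : 0 < x -> x <= y ->
  (P `]x, y]%classic = \int[lambda]_(t in `]x, y]) (g t)%:E)%E.
Proof.
move=> x0 xy; rewrite CDF_itvoc// -[RHS](fineK (I_fin x0 xy)); congr EFin.
apply/eqP; rewrite -subr_eq0 -/(D x y) -normr_le0 leNgt; apply/negP => D0.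
pose c := (y - x) * (g x - g y).
(* Chosen so that [n.+1] exceeds [c / |D x y|]; as [2 ^+ n.+1] exceeds [n.+1], the bisection bound
   fails. *)
pose n := Num.truncn (c / `|D x y|).
have := D_bisect n.+1 x0 xy; rewrite -/c leNgt => /negP; apply.
rewrite mulrC -ltr_pdivrMr// (lt_le_trans (truncnS_gt _))//.
by rewrite -natrX ler_nat ltnW// ltn_expl.
Qed.

Lemma monotone_density_right_slope : monotone_density P g.
Proof.
split=> //.
- by move=> x x0; rewrite /right_slope ltNge x0.
have mD : measurable (`]0, +oo[%classic : set R) by [].
pose m1 := mrestr P mD.
pose m2 := mrestr (density_measure lambda mg g0) mD.
have m12 x y : 0 < x -> m1 `]x, y]%classic = m2 `]x, y]%classic.
  move=> x0; rewrite /m1 /m2 /mrestr.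
  have -> : (`]x, y] `&` `]0, +oo[)%classic = `]x, y]%classic :> set R.
    apply/setIidl => z /=; rewrite !in_itv/= andbT => /andP[xz _].
    exact: lt_trans xz.
  have [xy|yx] := leP x y; first exact: CDF_integral_right_slope.
  have -> : `]x, y]%classic = set0 :> set R.
    by apply: set_itv_ge; rewrite bnd_simp -leNgt ltW.
  by transitivity (0 : \bar R)%E; [exact: measure0|exact/esym/measure0].
have m12A (A : set R) : measurable A -> m1 A = m2 A.
  apply: (@measure_unique _ R (measurableTypeR R) (@RGenInftyO.G R)
    (fun n => `]-oo, n%:R[%classic) _ _ _ _ (mrestr P mD)
    (mrestr (density_measure lambda mg g0) mD)).
  - exact: RGenInftyO.measurableE.
  - move=> _ _ [x ->] [y ->]; exists (Num.min x y).
    by apply/seteqP; split => z /=; rewrite !in_itv/= lt_min => /andP.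
  - by move=> n; exists n%:R.
  - apply/seteqP; split => // x _; exists (Num.truncn x).+1 => //=.
    by rewrite in_itv/= truncnS_gt.
  - move=> _ [x ->].
    (* Increments are known only for left endpoints above 0, so the trace of []-oo, x[] on ]0, +oo[
       is exhausted by intervals bounded away from 0. *)
    pose B n := (`]n.+1%:R^-1, x - n.+1%:R^-1]%classic : set R).
    have mB n : measurable (B n) by exact: measurable_itv.
    have B_nd : nondecreasing_seq B.
      move=> n m nm; apply/subsetPset; apply: subset_itv; rewrite bnd_simp.
        by rewrite lef_pV2 ?posrE// ler_nat.
      by rewrite lerB// lef_pV2 ?posrE// ler_nat.
    have UB : \bigcup_n B n = `]0, x[%classic.
      apply/seteqP; split => z /=; rewrite in_itv/=.
        move=> [n _]; rewrite /B/= in_itv/= => /andP[nz zx].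
        have n0 : 0 < n.+1%:R^-1 :> R by rewrite invr_gt0.
        by rewrite (lt_trans n0 nz) (le_lt_trans zx)// ltrBlDr ltrDl.
      move=> /andP[z0 zx]; pose e := Num.min z (x - z).
      have e0 : 0 < e by rewrite lt_min z0 subr_gt0.
      exists (Num.truncn e^-1) => //; rewrite /B/= in_itv/=.
      have ne : (Num.truncn e^-1).+1%:R^-1 < e.
        by rewrite invf_plt ?posrE// truncnS_gt.
      by move: ne; rewrite lt_min => /andP[-> /ltW] /=; rewrite lerBrDl lerBrDr.
    have mE (m : {measure set (measurableTypeR R) -> \bar R}) :
        mrestr m mD `]-oo, x[%classic = limn (mrestr m mD \o B).
      transitivity (mrestr m mD (\bigcup_n B n)).
        rewrite UB /mrestr; congr (m _); apply/seteqP; split => z /=;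
          rewrite !in_itv/= !andbT.
          by move=> [-> ->].
        by move=> [/andP[-> ->]].
      apply/esym/cvg_lim => //; apply: nondecreasing_cvg_mu => //.
      by apply: bigcup_measurable => k _; exact: mB.
    transitivity (limn (mrestr P mD \o B)); first exact: mE.
    transitivity (limn (mrestr (density_measure lambda mg g0) mD \o B));
      last exact/esym/mE.
    congr (limn _); apply/funext => n /=.
    by apply: m12; rewrite invr_gt0.
  - move=> n; rewrite /m1 /mrestr (@le_lt_trans _ _ 1%E) ?ltry// probability_le1//.
    exact: measurableI.
move=> A mA; transitivity (m1 A); first by [].
rewrite m12A// /m2 /mrestr /density_measure.
rewrite integral_mkcond [RHS]integral_mkcond; apply: eq_integral => x _.
rewrite !patchE in_setI; case: (x \in A) => //=; case: ifPn => //.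
rewrite notin_setE/= in_itv/= andbT => /negP; rewrite -leNgt => x0.
by rewrite /right_slope (ltNge 0 x) x0.
Qed.

End density.

(** * Laws on the half-line without atoms off 0 *)

Section continuity.
Context (R : realType) (m : {measure set (measurableTypeR R) -> \bar R}).
Hypothesis m_fin : (m setT < +oo)%E.
Hypothesis m_no_atom : forall x : R, m [set x] = 0%E.

Let fin A : measurable A -> m A \is a fin_num.
Proof.
move=> mA; rewrite ge0_fin_numE// (le_lt_trans _ m_fin)// le_measure ?inE//.
Qed.

Let rayD (x y : R) : x <= y ->
  m `]-oo, y]%classic = (m `]-oo, x]%classic + m `]x, y]%classic)%E.
Proof.
move=> xy; rewrite -measureU//.
  congr (m _); apply/seteqP; split => z /=; rewrite !in_itv/=.
    by move=> zy; case: (leP z x) => zx; [left|right].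
  by case=> [zx|/andP[]//]; rewrite (le_trans zx).
apply/seteqP; split => z //=; rewrite !in_itv/= => -[zx /andP[xz _]].
by move: xz; rewrite ltNge zx.
Qed.

(** The mass of ]x - 1/(n+1), x + 1/(n+1)] decreases to the mass of [{x}], which is 0, and it bounds
    the oscillation of the ray function over that interval. *)
Lemma continuous_ray_measure : continuous (fun y : R => fine (m `]-oo, y]%classic)).
Proof.
move=> x; apply/cvgrPdist_lt => e e0.
pose B n : set R := `]x - n.+1%:R^-1, x + n.+1%:R^-1]%classic.
have mB n : measurable (B n) by exact: measurable_itv.
have B_ni : nonincreasing_seq B.
  move=> n k nk; apply/subsetPset; apply: subset_itv; rewrite bnd_simp.
    by rewrite lerB// lef_pV2 ?posrE// ler_nat.
  by rewrite lerD2l lef_pV2 ?posrE// ler_nat.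
have IB : \bigcap_n B n = [set x].
  apply/seteqP; split => z /=; last first.
    move=> -> n _; rewrite /B/= in_itv/= ltrBlDr ltrDl lerDl.
    by rewrite invr_gt0 ltr0n/= invr_ge0.
  move=> zB; apply/eqP; rewrite -subr_eq0 -normr_le0 leNgt; apply/negP => d0.
  have /= := zB (Num.truncn `|z - x|^-1) I; rewrite /B/= in_itv/= => /andP[z1 z2].
  have : (Num.truncn `|z - x|^-1).+1%:R^-1 < `|z - x|.
    by rewrite invf_plt ?posrE// truncnS_gt.
  rewrite ltNge => /negP; apply; rewrite ler_norml.
  by move: z1 z2; set r := _^-1; lra.
have : (m \o B) n @[n --> \oo] --> 0%E.
  rewrite -(m_no_atom x) -IB; apply: nonincreasing_cvg_mu => //.
  - by rewrite /= -ge0_fin_numE//; apply: fin; exact: mB.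
  - by apply: bigcapT_measurable => k; exact: mB.
move=> /fine_cvgP[_ /cvgrPdist_lt/(_ _ e0)] [N _ /(_ N (leqnn _))] /=.
rewrite sub0r normrN ger0_norm ?fine_ge0// => mBe.
exists N.+1%:R^-1 => /=; first by rewrite invr_gt0.
move=> y /=; set r := N.+1%:R^-1 in mBe *; rewrite ltr_norml => /andP[y1 y2].
have mono u v : u <= v -> fine (m `]-oo, u]%classic) <= fine (m `]-oo, v]%classic).
  move=> uv; rewrite fine_le ?fin// le_measure ?inE//; exact: subset_itvl.
have E : fine (m `]-oo, x + r]%classic) = fine (m `]-oo, x - r]%classic) + fine (m (B N)).
  rewrite -fineD ?fin//; last exact: mB.
  by congr fine; apply: rayD; rewrite lerBlDr -addrA lerDl addr_ge0// ltW// invr_gt0.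
have := mono y (x + r) ltac:(lra); have := mono (x - r) y ltac:(lra).
have := mono x (x + r) ltac:(lra); have := mono (x - r) x ltac:(lra).
by rewrite ltr_norml E => *; apply/andP; split; lra.
Qed.

End continuity.

Section halfline.
Context (R : realType) (P : probability (measurableTypeR R) R).
Hypothesis P0 : on_halfline P.

Lemma halfline_decomp (A : set R) : measurable A ->
  P A = (P (A `&` [set 0%R]) + P (A `&` `]0%R, +oo[%classic))%E.
Proof.
move=> mA; have m0 : measurable [set 0 : R] by exact: measurable_set1.
have -> : P A = P (A `&` `[0%R, +oo[%classic).
  have /= := measureDI P mA (measurable_itv `[0%R, +oo[) => ->.
  rewrite [X in (X + _)%E](_ : _ = 0%E) ?add0e//.
  apply: subset_measure0 P0 => //; first exact: measurableD.
  by move=> x /= [_]; rewrite !in_itv/= andbT => /negP; rewrite -ltNge.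
rewrite -measureU//=; [|exact: measurableI|exact: measurableI|].
- congr (P _); apply/seteqP; split => x /=; rewrite !in_itv/= !andbT.
    move=> [Ax]; rewrite le_eqVlt => /predU1P[x0|x0]; last by right.
    by left; split.
  by move=> [[Ax x0]|[Ax /ltW//]]; split => //; rewrite x0.
- apply/seteqP; split => x //= [[_ ->]]; by rewrite in_itv/= ltxx => -[].
Qed.

Lemma halfline_CDF (y : R) : 0 <= y ->
  CDF P y = fine (P [set 0%R]) + fine (P (`]-oo, y]%classic `&` `]0%R, +oo[%classic)).
Proof.
move=> y0; rewrite -fineD ?fin_num_measure//; last 1 first.
  exact: measurableI.
rewrite /CDF; congr fine; rewrite halfline_decomp//; congr (P _ + _)%E.
by apply/setIidr => x /= ->; rewrite in_itv.
Qed.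

Lemma halfline_CDF0 : (CDF P 0)%:E = P [set 0].
Proof.
rewrite CDF_fin halfline_decomp//.
rewrite [X in (_ + X)%E](_ : _ = 0%E) ?adde0; last first.
  rewrite -(measure0 P); congr (P _); apply/seteqP; split => x //=.
  by rewrite !in_itv/= andbT => -[x0]; rewrite ltNge x0.
by congr (P _); apply/setIidr => x /= ->; rewrite in_itv/=.
Qed.

End halfline.

Section dominated.
Context (R : realType) (Q : probability (measurableTypeR R) R).
Hypothesis QU : dominated_by_class Q (U0p R).
Local Notation lambda := (@lebesgue_measure R).

(** Apart from an atom at 0, every member of [U0p] has a Lebesgue density on ]0, +oo[. Later uses of
    domination by the class all go through this fact. *)
Lemma dominated_by_U0p_null (A : set R) : measurable A ->
  lambda A = 0%E -> ~ A 0 -> Q A = 0%E.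
Proof.
move=> mA A0 nA0; apply: QU => // P [P0 Pc].
have [mg g0 _ _ PE] := monotone_density_right_slope Pc.
rewrite (halfline_decomp P0)// PE// [X in (X + _)%E](_ : _ = 0%E) ?add0e.
  by apply: null_set_integral => //; apply/measurable_EFinP; exact: measurable_funTS.
rewrite (_ : A `&` _ = set0) ?measure0//.
by apply/seteqP; split => x //= [Ax x0]; apply: nA0; rewrite -x0.
Qed.

Lemma dominated_by_U0p_atom x : x != 0 -> Q [set x] = 0%E.
Proof.
move=> x0; apply: dominated_by_U0p_null => //.
  by rewrite -set_itv1 lebesgue_measure_itv/= ltxx.
by move=> /= xE; move: x0; rewrite -xE eqxx.
Qed.

Hypothesis Q0 : on_halfline Q.

Lemma CDF_tilted_max s : 0 < s ->
  exists2 t, 0 <= t & forall y, 0 <= y -> CDF Q y - s * y <= CDF Q t - s * t.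
Proof.
move=> s0; have mD : measurable (`]0, +oo[%classic : set R) by [].
(* An atom at 0 makes the CDF jump there. [h] omits it, is continuous on the whole line, and differs
   from the CDF on the half-line by a constant. *)
pose h y := fine (Q (`]-oo, y]%classic `&` `]0%R, +oo[%classic)).
have ch : continuous h.
  apply: (@continuous_ray_measure _ (mrestr Q mD)) => [|x].
    rewrite /mrestr (@le_lt_trans _ _ 1%E) ?ltry// probability_le1//.
    exact: measurableI.
  change (Q ([set x] `&` `]0, +oo[%classic) = 0%E).
  have [->|x0] := eqVneq x 0.
    rewrite (_ : _ `&` _ = set0) ?measure0//.
    by apply/seteqP; split => y //= [->]; rewrite in_itv/= ltxx.
  apply: subset_measure0 (dominated_by_U0p_atom x0) => //; exact: measurableI.
pose k y := h y - s * y.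
have ck : continuous k.
  move=> x; apply: cvgB; first exact: ch.
  exact: cvgM (@cvg_cst _ _ _ _ _) (@cvg_id _ _).
(* Beyond [s^-1] the tilted CDF is negative because the CDF is at most 1, while at 0 it is
   nonnegative; a maximum over [[0, s^-1]] is therefore global. *)
have [|t] := @EVT_max R k 0 s^-1 _ (continuous_subspaceT ck).
  by rewrite invr_ge0 ltW.
rewrite in_itv/= => /andP[t0 ts] tmax; exists t => // y y0.
have kE z : 0 <= z -> CDF Q z - s * z = fine (Q [set 0]) + k z.
  by move=> z0; rewrite halfline_CDF// addrA.
have max0 : CDF Q 0 - s * 0 <= CDF Q t - s * t.
  by rewrite !kE// lerD2l tmax// in_itv/= lexx invr_ge0 ltW.
have [ys|sy] := leP y s^-1.
  by rewrite !kE// lerD2l tmax// in_itv/= y0 ys.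
apply: le_trans max0; rewrite mulr0 subr0 (le_trans _ (CDF_ge0 Q 0))//.
have : 1 < s * y by rewrite mulrC -ltr_pdivrMr// div1r.
by have := CDF_le1 Q y; lra.
Qed.

End dominated.

(** * The least concave majorant *)

Lemma integral_monotone_density (R : realType)
    (P : probability (measurableTypeR R) R) (g f : R -> R) :
  monotone_density P g -> measurable_fun setT f -> (forall x, 0 <= f x) ->
  (forall x, x <= 0 -> f x = 0) ->
  (\int[P]_x (f x)%:E = \int[@lebesgue_measure R]_x (f x * g x)%:E)%E.
Proof.
move=> [mg g0 _ _ PE] mf f0 fN; apply: integral_density_superlevel => // s s0.
have mS : measurable [set x | s < f x] by exact: measurable_superlevel.
transitivity (P ([set x | s < f x] `&` `]0, +oo[%classic)); last exact: PE.
congr (P _); apply/esym/setIidl => x /= sfx; rewrite in_itv/= andbT ltNge.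
by apply/negP => x0; move: sfx; rewrite fN// ltNge ltW.
Qed.

Lemma integral_set1 d (T : measurableType d) (R : realType)
    (mu : {measure set T -> \bar R}) (f : T -> R) (a : T) :
  measurable [set a] ->
  (\int[mu]_(x in [set a]) (f x)%:E = (f a)%:E * mu [set a])%E.
Proof.
move=> ma; rewrite -integral_cst//.
by apply: eq_integral => x; rewrite inE/= => ->.
Qed.

(** A density integrates to 0 over each measurable part of a null set, so it vanishes almost
    everywhere there. This carries a condition on zeros of arbitrarily chosen densities over to the
    set [{g = 0}]. *)
Lemma density_null (R : realType) (P : probability (measurableTypeR R) R)
    (f : R -> R) (B : set R) :
  is_density P f -> measurable B -> B `<=` `]0, +oo[%classic -> P B = 0%E ->
  @lebesgue_measure R (B `&` [set x | f x != 0]) = 0%E.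
Proof.
move=> [mf _ Pf _] mB BD PB0.
have Pf0 (B' : set R) : measurable B' -> B' `<=` B ->
    (\int[@lebesgue_measure R]_(x in B') (f x)%:E = 0)%E.
  move=> mB' B'B; have := Pf _ mB'.
  have -> : P B' = 0%E by apply: subset_measure0 PB0.
  rewrite diracE memNset; last first.
    by move=> /B'B/BD; rewrite /= in_itv/= ltxx.
  by rewrite mule0 adde0 (setIidl (subset_trans B'B BD)).
have mp : measurable (B `&` [set x | 0 < f x]).
  by apply: measurableI => //; exact: measurable_superlevel.
have mfN : measurable_fun setT (fun x => - f x) by exact: measurableT_comp.
have mn : measurable (B `&` [set x | 0 < - f x]).
  by apply: measurableI => //; exact: measurable_superlevel.
have p0 : @lebesgue_measure R (B `&` [set x | 0 < f x]) = 0%E.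
  by apply: (@measure_eq0_of_integral _ _ _ (@lebesgue_measure R) f) => //;
    [move=> x []|rewrite Pf0].
have n0 : @lebesgue_measure R (B `&` [set x | 0 < - f x]) = 0%E.
  apply: (@measure_eq0_of_integral _ _ _ (@lebesgue_measure R) (fun x => - f x)) => //;
    first by move=> x [].
  have e : (\int[@lebesgue_measure R]_(x in B `&` [set x | (0 < - f x)%R]) (f x)%:E =
      - \int[@lebesgue_measure R]_(x in B `&` [set x | (0 < - f x)%R]) (- f x)%:E)%E.
    rewrite -integral_ge0N; last by move=> x [_ /ltW]; rewrite lee_fin.
    by apply: eq_integral => x _; rewrite EFinN oppeK.
  by have := Pf0 _ mn (@subIsetl _ _ _); rewrite e => /eqP; rewrite oppe_eq0 => /eqP.
apply: subset_measure0 (_ : @lebesgue_measure R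
    ((B `&` [set x | 0 < f x]) `|` (B `&` [set x | 0 < - f x])) = 0%E).
- apply: measurableI => //.
  rewrite (_ : [set x | f x != 0] = ~` [set x | f x = 0]).
    by apply: measurableC; exact: measurable_level0.
  by apply/seteqP; split => x /eqP.
- exact: measurableU.
- move=> x [Bx] /=; rewrite neq_lt => /orP[fx|fx]; [right|left]; split => //=.
  by rewrite oppr_gt0.
- by rewrite -[RHS]p0; apply: measureU0.
Qed.

Section least_concave_majorant.
Context (R : realType) (Q Qt : probability (measurableTypeR R) R).
Hypothesis Q0 : on_halfline Q.
Hypothesis QU : dominated_by_class Q (U0p R).
Hypothesis QQt : is_least_concave_majorant Q Qt.
Local Notation lambda := (@lebesgue_measure R).
Local Notation g := (right_slope (CDF Qt)).
Local Notation D := (`]0%R, +oo[%classic : set R).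

Let Qt0 : on_halfline Qt. Proof. by have [[]] := QQt. Qed.
Let Qt_concave : concave_on_halfline (CDF Qt). Proof. by have [[]] := QQt. Qed.
Let le_QQt x : 0 <= x -> CDF Q x <= CDF Qt x.
Proof. by have [_ H _] := QQt; exact: H. Qed.

Lemma majorant_right_slope_density : monotone_density Qt g.
Proof. exact: monotone_density_right_slope. Qed.
Let gP := majorant_right_slope_density.
Let mg : measurable_fun setT g. Proof. by have [] := gP. Qed.
Let g0 : forall x, 0 <= g x. Proof. by have [] := gP. Qed.

(* The tilted CDFs [F y - s y] of [Q] and of its majorant have the same
   supremum, because an affine majorant of the first is one of the second. *)
Lemma majorant_contact s : 0 < s -> exists t,
  [/\ 0 <= t, CDF Q t = CDF Qt t,
      forall y, 0 < y -> y < t -> s <= g y &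
      forall y, t < y -> g y <= s].
Proof.
move=> s0; have [t t0 tmax] := CDF_tilted_max QU Q0 s0.
have line y : 0 <= y -> CDF Qt y <= CDF Q t + s * (y - t).
  move=> y0; have [_ _ /(_ (fun y => CDF Q t + s * (y - t)))] := QQt; apply => //.
    by move=> x z u _ _ _; rewrite le_eqVlt; apply/orP; left; apply/eqP; ring.
  by move=> x /tmax; lra.
have tE : CDF Q t = CDF Qt t.
  by apply/eqP; rewrite eq_le le_QQt//= (le_trans (line t t0))// subrr mulr0 addr0.
exists t; split => // [y y0 yt|y ty].
  apply: le_trans (le_right_slope Qt_concave y0 yt).
  by rewrite ler_pdivlMr ?subr_gt0//; have := line y (ltW y0); lra.
apply: le_trans (right_slope_le Qt_concave t0 ty) _.
by rewrite ler_pdivrMr ?subr_gt0//; have := line y (ltW (le_lt_trans t0 ty)); lra.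
Qed.

Local Notation U s x := ([set y : R | 0 < y /\ g y < s] `&` `]-oo, x]%classic).

Let posE (p : R -> Prop) : [set y | 0 < y /\ p y] = D `&` [set y | p y].
Proof. by apply/seteqP; split => y /=; rewrite in_itv/= andbT. Qed.

Let mU s x : measurable (U s x).
Proof.
apply: measurableI => //; rewrite posE; apply: measurableI => //.
exact: measurable_sublevel.
Qed.

Let mZ : measurable [set y | 0 < y /\ g y = 0].
Proof. by rewrite posE; apply: measurableI => //; exact: measurable_level0. Qed.

Let m0 : measurable ([set 0] : set (measurableTypeR R)).
Proof. exact: measurable_set1. Qed.

(** Let [t] be the contact point for [s']. On ]0, +oo[ the set [{g < s'}] lies in [t, +oo[, and ]t,
    +oo[ lies in [{g <= s'}], hence in [{g < s}]. Between them, [Q] gives ]t, x] at most the mass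
    [Qt] does, since the CDFs agree at [t] and are ordered at [x]. *)
Lemma majorant_sublevel_lt s' s x : 0 < s' -> s' < s ->
  (Q (U s' x) <= Qt (U s x))%E.
Proof.
move=> s'0 s's; have [t [t0 tE tl tr]] := majorant_contact s'0.
have [xt|tx] := leP x t.
  (* No slope below [s'] occurs before [t], so for [x <= t] the set [U s' x] has at most the point
     [x], and is empty if [x <= 0]. *)
  rewrite (_ : Q _ = 0%E)//; apply/eqP; rewrite -measure_le0.
  have [x0|x0] := leP x 0.
    rewrite (_ : U s' x = set0) ?measure0//; apply/seteqP; split => y //=.
    by rewrite /= in_itv/= => -[[y0 _] yx]; move: (lt_le_trans y0 yx); rewrite ltNge x0.
  have nx : x != 0 by rewrite gt_eqF.
  rewrite -(dominated_by_U0p_atom QU nx); apply: le_measure; rewrite ?inE//;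
    first exact: mU.
  move=> y; rewrite /= in_itv/= => -[[y0 ys] yx].
  apply/eqP; rewrite eq_le yx/= leNgt; apply/negP => xy.
  by have := tl y y0 (lt_le_trans xy xt); rewrite leNgt ys.
have mt : measurable [set t] by exact: measurable_set1.
have QU' : (Q (U s' x) <= Q `]t, x]%classic)%E.
  have [t00|tn0] := eqVneq t 0.
    apply: le_measure; rewrite ?inE//; first exact: mU.
    move=> y; rewrite /= !in_itv/= t00.
    by move=> [[-> _] ->].
  apply: (@le_trans _ _ (Q ([set t] `|` `]t, x]%classic))).
    apply: le_measure; rewrite ?inE; [exact: mU|exact: measurableU|].
    move=> y; rewrite /= !in_itv/= => -[[y0 ys] yx].
    have [ty|yt|->] := ltgtP t y; [by right|exfalso|by left].
    by have := tl y y0 yt; rewrite leNgt ys.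
  rewrite (le_trans (measureU2 _ _ _))// -[leRHS]add0e leeD2r//.
  by rewrite -(dominated_by_U0p_atom QU tn0).
apply: le_trans QU' _; apply: (@le_trans _ _ (Qt `]t, x]%classic)).
  rewrite (@CDF_itvoc R Q _ _ (ltW tx)) (@CDF_itvoc R Qt _ _ (ltW tx)) lee_fin tE.
  rewrite lerB// le_QQt//.
  exact: le_trans t0 (ltW tx).
apply: le_measure; rewrite ?inE//; first exact: mU.
move=> y; rewrite /= !in_itv/= => /andP[ty yx].
by split => //; split; [exact: le_lt_trans ty|exact: le_lt_trans (tr _ ty) s's].
Qed.

(** Since [g < s] is strict, [U s x] is the increasing union of the sets with a smaller threshold,
    and continuity from below closes the gap between [s'] and [s]. *)
Lemma majorant_sublevel_le s x : (Q (U s x) <= Qt (U s x))%E.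
Proof.
pose B n := U (s - n.+1%:R^-1) x.
have UB : \bigcup_n B n = U s x.
  apply/seteqP; split => y.
    move=> [n _] [[y0 gy] yx]; split => //; split => //.
    by rewrite (lt_trans gy)// ltrBlDr ltrDl.
  move=> [[y0 gy] yx]; exists (Num.truncn (s - g y)^-1) => //; split => //; split => //.
  rewrite ltrBrDl -ltrBrDr invf_plt ?posrE ?subr_gt0//.
  by rewrite truncnS_gt.
have B_nd : nondecreasing_seq B.
  move=> n m nm; apply/subsetPset => y [[y0 gy] yx]; split => //; split => //.
  by rewrite (lt_le_trans gy)// lerB// lef_pV2 ?posrE// ler_nat.
have cvgB : Q (B n) @[n --> \oo] --> Q (U s x).
  rewrite -UB; apply: nondecreasing_cvg_mu => //.
  - by move=> n; exact: mU.
  - by apply: bigcupT_measurable => n; exact: mU.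
rewrite -(cvg_lim _ cvgB)//; apply: lime_le; first by apply/cvg_ex; eexists;
  exact: cvgB.
apply: nearW => n.
have [sn|sn] := ltP 0 (s - n.+1%:R^-1).
  by apply: majorant_sublevel_lt => //; rewrite ltrBlDr ltrDl.
rewrite (_ : B n = set0) ?measure0//; apply/seteqP; split => y // [[_ /=]].
by move=> gy; have := le_lt_trans (g0 y) gy; rewrite ltNge sn.
Qed.

(** On ]0, n] the set [{g < s}] has [Qt]-mass at most [s * n], hence so does [Q], and [s] is
    arbitrary. Domination by the class does not give this, because [{g = 0}] may have positive
    Lebesgue measure. *)
Lemma Q_slope0_null : Q [set y | 0 < y /\ g y = 0] = 0%E.
Proof.
pose Z x := [set y | 0 < y /\ g y = 0] `&` `]-oo, x]%classic : set R.
have QZ n : Q (Z n%:R) = 0%E.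
  apply/eqP; rewrite -measure_le0; apply/lee_addgt0Pr => e e0; rewrite add0e.
  (* The denominator [n.+1] keeps [s] positive when [n = 0]. *)
  pose s := e / n.+1%:R.
  have s0 : 0 < s by rewrite divr_gt0.
  apply: (@le_trans _ _ (Q (U s n%:R))).
    apply: le_measure; rewrite ?inE; [exact: measurableI|exact: mU|].
    by move=> y [[y0 gy] yn]; split => //; split => //; rewrite gy.
  apply: le_trans (majorant_sublevel_le _ _) _.
  have UD : U s n%:R `<=` D by move=> y [[y0 _] _]; rewrite /= in_itv/= y0.
  have -> : Qt (U s n%:R) = Qt (U s n%:R `&` D) by congr (Qt _); apply/esym/setIidl.
  have [_ _ _ _ ->] := gP; last exact: mU.
  apply: (@le_trans _ _ (\int[lambda]_(y in U s n%:R) s%:E)%E).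
    apply: ge0_le_integral => //; first exact: mU.
    - by move=> y _; rewrite lee_fin.
    - by apply/measurable_EFinP; exact: measurable_funTS.
    - by move=> y [[_ /ltW gy] _]; rewrite lee_fin.
  rewrite integral_cst; last exact: mU.
  apply: (@le_trans _ _ (s%:E * lambda `]0%R, n%:R]%classic)%E).
    apply: lee_wpmul2l; first by rewrite lee_fin ltW.
    apply: (@le_measure _ _ _ lambda); rewrite ?inE//; first exact: mU.
    by move=> y [[y0 _]]; rewrite /= !in_itv/= y0.
  rewrite lebesgue_measure_itv/= lte_fin; case: ifPn => n0; last first.
    by rewrite mule0 lee_fin ltW.
  rewrite oppr0 adde0 -EFinM lee_fin /s mulrAC ler_pdivrMr// ler_pM2l// ler_nat.
  by [].
apply: subset_measure0 (_ : Q (\bigcup_n Z n%:R) = 0%E) => //.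
- by apply: bigcupT_measurable => n; exact: measurableI.
- move=> y Zy; exists (Num.truncn y).+1 => //; split => //=.
  by rewrite in_itv/= ltW// truncnS_gt.
- have mZn n : measurable (Z n%:R) by exact: measurableI.
  apply/negligibleP; first exact: bigcupT_measurable.
  by apply: negligible_bigcup => n; apply/negligibleP; [exact: mZn|exact: QZ].
Qed.

Lemma majorant_slope0_null : Qt [set y | 0 < y /\ g y = 0] = 0%E.
Proof.
have [_ _ _ _ PE] := gP.
rewrite posE setIC PE; last exact: measurable_level0.
by apply: integral0_eq => x /= ->.
Qed.

Lemma majorant_atom_le : (Q [set 0%R] <= Qt [set 0%R])%E.
Proof. by rewrite -!halfline_CDF0// lee_fin; have [_ + _] := QQt; apply. Qed.

(** Three pieces of a [Qt]-null set: the atom at 0 is bounded by the CDFs at 0; the part in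
    [{0 < g}] is Lebesgue-null, hence [Q]-null; the remaining part lies in [{g = 0}], where [Q] has
    no mass. *)
Lemma majorant_dominates : Q `<< Qt.
Proof.
apply/null_content_dominatesP => A mA QtA.
have [_ _ _ _ PE] := gP.
rewrite (halfline_decomp Q0)// [X in (X + _)%E](_ : _ = 0%E) ?add0e; last first.
  have [A0|nA0] := pselect (A 0); last first.
    rewrite (_ : _ `&` _ = set0) ?measure0//.
    by apply/seteqP; split => x //= [+ x0]; rewrite x0.
  apply/eqP; rewrite -measure_le0 (@le_trans _ _ (Q [set 0%R]))//.
    by apply: le_measure; rewrite ?inE//; exact: measurableI.
  apply: le_trans majorant_atom_le _; rewrite -QtA.
  by apply: le_measure; rewrite ?inE// => x /= ->.
pose B := A `&` [set x | 0 < g x].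
have mB : measurable B by apply: measurableI => //; exact: measurable_superlevel.
have lB : lambda B = 0%E.
  apply: (@measure_eq0_of_integral _ _ _ lambda g) => //; first by move=> x [].
  rewrite -PE//; apply: subset_measure0 QtA => //; first exact: measurableI.
  by move=> x [[]].
have QB : Q B = 0%E.
  apply: (dominated_by_U0p_null QU) => //.
  by case; rewrite /= /right_slope ltxx ltxx.
apply: subset_measure0 (_ : Q (B `|` [set y | 0 < y /\ g y = 0]) = 0%E).
- exact: measurableI.
- exact: measurableU.
- move=> x [Ax]; rewrite /= in_itv/= andbT => x0.
  by have := g0 x; rewrite le_eqVlt => /predU1P[<-|gx]; [right|left].
- by rewrite measureU0//; exact: Q_slope0_null.
Qed.

(** The layers of [1/g] are sublevel sets of [g], except that [{g = 0}] is missing from them because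
    [1/g] reads 0 there. That set is [Qt]-null and can be added back on the right-hand side. *)
Lemma integral_inv_slope_le x :
  (\int[Q]_y ((g y)^-1 * \1_(`]0%R, x]%classic) y)%:E <=
   \int[Qt]_y ((g y)^-1 * \1_(`]0%R, x]%classic) y)%:E)%E.
Proof.
under eq_integral do rewrite EFinM.
under [leRHS]eq_integral do rewrite EFinM.
have mgV : measurable_fun setT (fun y => (g y)^-1) by exact: measurable_funV.
have gV0 y : 0 <= (g y)^-1 by rewrite invr_ge0.
have mw : measurable_fun setT (\1_(`]0%R, x]%classic) : R -> R) by exact: measurable_indic.
apply: layer_cake_le => //; do ?[exact/measurable_EFinP].
move=> s s0; have mS := measurable_superlevel s mgV.
rewrite !integral_indic//.
pose W := U s^-1 x; have mW : measurable W by exact: mU.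
have mSx : measurable (`]0, x]%classic `&` [set y | s < (g y)^-1]) by exact: measurableI.
apply: (@le_trans _ _ (Q W)).
  apply: le_measure; rewrite ?inE//.
  move=> y [] /=; rewrite !in_itv/= => /andP[y0 yx] sg; split => //; split => //.
  have gy : 0 < g y by rewrite -invr_gt0 (lt_trans s0).
  by rewrite -(invrK (g y)) ltf_pV2// posrE// invr_gt0.
apply: (le_trans (majorant_sublevel_le _ _)).
apply: (@le_trans _ _ (Qt ((`]0, x]%classic `&` [set y | s < (g y)^-1])
    `|` [set y | 0 < y /\ g y = 0]))); last first.
  by rewrite measureU0//; exact: majorant_slope0_null.
apply: le_measure; rewrite ?inE//; first exact: measurableU.
move=> y [[y0 gy]] /=; rewrite !in_itv/= y0 => yx.
have [gy0|gy0] : 0 = g y \/ 0 < g y by apply/predU1P; rewrite -le_eqVlt.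
  by right; rewrite -gy0.
by left; split => //; rewrite -(invrK s) ltf_pV2// posrE// invr_gt0.
Qed.

(** The condition on versions expressed through the canonical density [g] and up to Lebesgue-null
    sets, hence free of a choice of densities. *)
Definition slope_version (E : R -> R) :=
  [/\ is_RN_derivative Q Qt E, E 0 <= 1 &
    {ae lambda, forall x, 0 < x -> g x = 0 -> E x <= 1}].

(** Where [g] is positive, Lebesgue measure is [1/g] times [Qt], so [E] integrates there to the
    integral of [1/g] against [Q], at most that against [Qt], which is the Lebesgue measure of that
    part of ]0, x]. Where [g = 0], the bound [E <= 1] suffices. *)
Lemma slope_version_integral_le E x : slope_version E -> 0 <= x ->
  (\int[lambda]_(t in `[0%R, x]) (E t)%:E <= x%:E)%E.
Proof.
move=> [RN _ E1] x0; have [mE E0 _] := RN.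
pose w : R -> R := \1_(`]0%R, x]%classic).
have w0 y : 0 <= w y by [].
have wN y : y <= 0 -> w y = 0.
  by move=> y0; rewrite /w indicE memNset//= in_itv/= ltNge y0.
have mgV : measurable_fun setT (fun y => (g y)^-1) by exact: measurable_funV.
have gV0 y : 0 <= (g y)^-1 by rewrite invr_ge0.
have mw : measurable_fun setT w by exact: measurable_indic.
have mgVw : measurable_fun setT (fun y => (g y)^-1 * w y) by exact: measurable_funM.
have := integral_inv_slope_le x; rewrite -/w.
rewrite (RN_change_of_variables RN)//; last by move=> y; rewrite mulr_ge0.
rewrite (integral_monotone_density gP)//; last 3 first.
- exact: measurable_funM.
- by move=> y; rewrite !mulr_ge0.
- by move=> y y0; rewrite wN// mulr0 mul0r.
rewrite (integral_monotone_density gP)//; last 2 first.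
- by move=> y; rewrite mulr_ge0.
- by move=> y y0; rewrite wN// mulr0.
move=> leW.
pose z y : R := \1_[set y | g y = 0] y.
have mz : measurable_fun setT z.
  by apply: measurable_indic; exact: measurable_level0.
have z0 y : 0 <= z y by [].
have gz y : (g y)^-1 * g y + z y = 1.
  rewrite /z indicE; have [gy|gy] := eqVneq (g y) 0.
    by rewrite gy mulr0 mem_set// add0r.
  by rewrite mulVf// memNset ?addr0//=; exact/eqP.
have leZ : (\int[lambda]_y (w y * z y * E y)%:E <= \int[lambda]_y (w y * z y)%:E)%E.
  apply: ae_ge0_le_integral => //.
  - by move=> y _; rewrite lee_fin !mulr_ge0.
  - apply/measurable_EFinP; apply: measurable_funM => //; exact: measurable_funM.
  - by move=> y _; rewrite lee_fin !mulr_ge0.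
  - by apply/measurable_EFinP; exact: measurable_funM.
  - have [N [mN N0 sub]] := E1; exists N; split => // y /= nH; apply: sub => /= Ey.
    apply: nH => _; rewrite lee_fin -[leRHS]mulr1.
    rewrite /w /z !indicE; case: (boolP (y \in `]0, x]%classic));
      last by rewrite !mul0r.
    rewrite inE/= in_itv/= => /andP[y0 _].
    case: (boolP (y \in _)); last by rewrite !(mulr0, mul0r).
    by rewrite inE/= => /(Ey y0); rewrite !mul1r.
apply: (@le_trans _ _ (\int[lambda]_y (w y * E y)%:E)%E).
  rewrite -(@integral_itv_obnd_cbnd _ _ _ (fun t => (E t)%:E)).
    rewrite integral_mkcond le_eqVlt; apply/predU1P; left.
    apply: eq_integral => y _.
    by rewrite patchE /w indicE; case: ifPn => _; rewrite ?mul1r ?mul0r.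
  by apply/measurable_EFinP; exact: measurable_funTS.
have split_int (f : R -> R) : measurable_fun setT f -> (forall y, 0 <= f y) ->
    (\int[lambda]_y (w y * f y)%:E =
     \int[lambda]_y ((g y)^-1 * w y * f y * g y)%:E +
     \int[lambda]_y (w y * z y * f y)%:E)%E.
  move=> mf f0; rewrite -ge0_integralD//.
  - apply: eq_integral => y _; rewrite -EFinD; congr EFin.
    rewrite -[LHS]mulr1 -(gz y); ring.
  - by move=> y _; rewrite lee_fin !mulr_ge0.
  - apply/measurable_EFinP; apply: measurable_funM => //; exact: measurable_funM.
  - by move=> y _; rewrite lee_fin !mulr_ge0.
  - apply/measurable_EFinP; apply: measurable_funM => //; exact: measurable_funM.
rewrite split_int//.
(* [x] is split in the same way, with [E] replaced by 1, and the two sums are compared term by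
   term. *)
have -> : x%:E = (\int[lambda]_y (w y * 1)%:E)%E.
  under eq_integral do rewrite mulr1.
  rewrite /w integral_indic// setIT.
  transitivity (lambda `]0%R, x]%classic); last by [].
  rewrite lebesgue_measure_itv/= lte_fin.
  by case: ltgtP x0 => // [_ _|<- _]; rewrite ?oppr0 ?adde0.
rewrite (split_int (cst 1))//.
have e1 y : (g y)^-1 * w y * cst 1 y * g y = (g y)^-1 * w y * g y by rewrite mulr1.
have e2 y : w y * z y * cst 1 y = w y * z y by rewrite mulr1.
under [X in (_ <= X + _)%E]eq_integral do rewrite e1.
under [X in (_ <= _ + X)%E]eq_integral do rewrite e2.
exact: leeD.
Qed.

Lemma slope_version_of_is_dQdQt E : is_dQdQt Q Qt E -> slope_version E.
Proof.
move=> [RN [fQ [fQt [dQ dQt fE]]]]; split => //.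
  have [mE E0 QE] := RN; have [_ _ _ fQ0] := dQ; have [_ _ _ fQt0] := dQt.
  have := QE _ m0; rewrite integral_set1// => QE0.
  have := majorant_atom_le; rewrite -fQ0 -fQt0 lee_fin => le0.
  have fQ_ge0 : 0 <= fQ 0 by rewrite -lee_fin fQ0.
  (* If [Qt] has no atom at 0, neither has [Q], and the condition on common zeros applies at 0
     because densities there are read as atoms. Otherwise [E 0] is the ratio of the atoms. *)
  have [f0|f0] := eqVneq (fQt 0) 0.
    by apply: fE => //; apply/eqP; rewrite eq_le fQ_ge0 andbT -[leRHS]f0.
  have f_gt0 : 0 < fQt 0 by rewrite lt_neqAle eq_sym f0 (le_trans fQ_ge0).
  rewrite -(ler_pM2r f_gt0) mul1r -lee_fin EFinM fQt0.
  by rewrite -QE0 -fQ0 -fQt0 lee_fin.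
(* The exceptional set: points of [{g = 0}] where one of the chosen densities does not vanish. *)
exists ([set y | 0 < y /\ g y = 0] `&` [set x | fQ x != 0] `|`
        [set y | 0 < y /\ g y = 0] `&` [set x | fQt x != 0]).
have ZD : [set y | 0 < y /\ g y = 0] `<=` D by rewrite posE; exact: subIsetl.
have mneq (f : R -> R) : measurable_fun setT f -> measurable [set x | f x != 0].
  move=> mf; rewrite (_ : [set x | f x != 0] = ~` [set x | f x = 0]).
    by apply: measurableC; exact: measurable_level0.
  by apply/seteqP; split => x /eqP.
have [mfQ _ _ _] := dQ; have [mfQt _ _ _] := dQt.
have h1 := density_null dQ mZ ZD Q_slope0_null.
have h2 := density_null dQt mZ ZD majorant_slope0_null.
split.
- by apply: measurableU; apply: measurableI => //; exact: mneq.
- apply/eqP; rewrite -measure_le0; apply: (le_trans (measureU2 _ _ _)).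
  + by apply: measurableI => //; exact: mneq.
  + by apply: measurableI => //; exact: mneq.
  + apply: (@le_trans _ _ (0 + 0)%E); last by rewrite adde0.
    by apply: leeD; rewrite measure_le0; apply/eqP; [exact: h1|exact: h2].
- move=> x /= /not_implyP[x0 /not_implyP[gx nE]].
  have [fx|fx] := eqVneq (fQ x) 0; last by left.
  right; split => //=; apply/negP => /eqP fx'.
  by apply: nE; apply: fE => //; exact: ltW.
Qed.

(** The claims on reverse information projections start from no given version, so one has to be
    produced. *)
Lemma slope_version_exists : exists E, slope_version E.
Proof.
have QQt_dom := majorant_dominates.
pose f := Radon_Nikodym_SigmaFinite.f Q Qt.
have f_fin := Radon_Nikodym_SigmaFinite.f_fin_num QQt_dom.
have f_ge0 := Radon_Nikodym_SigmaFinite.f_ge0 QQt_dom.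
have f_int := Radon_Nikodym_SigmaFinite.f_integrable QQt_dom.
have fE := Radon_Nikodym_SigmaFinite.f_integral QQt_dom.
have mf : measurable_fun setT (fine \o f).
  by apply: measurableT_comp => //; exact: measurable_int f_int.
have RN0 : is_RN_derivative Q Qt (fine \o f).
  split=> [//|x|A mA]; first exact: fine_ge0 (f_ge0 x).
  transitivity (\int[Qt]_(x in A) f x)%E; first exact: fE.
  by apply: eq_integral => x _; exact/esym/fineK/f_fin.
(* the value at a null atom and the values where the slope vanishes are free *)
pose Z : set R := [set y | 0 < y /\ g y = 0] `|` (if Qt [set 0] == 0%E then [set 0] else set0).
have mZ' : measurable Z by apply: measurableU => //; case: ifP.
have QtZ : Qt Z = 0%E.
  apply/eqP; rewrite -measure_le0; apply: (le_trans (measureU2 _ _ _)) => //.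
    by case: ifP.
  apply: (@le_trans _ _ (0 + 0)%E); last by rewrite adde0.
  apply: leeD; first by rewrite measure_le0; apply/eqP; exact: majorant_slope0_null.
  by rewrite measure_le0; case: ifPn => [//|_]; apply/eqP; exact: measure0.
pose E x := fine (f x) * \1_(~` Z) x.
have E_ge0 x : 0 <= E x by apply: mulr_ge0 => //; exact: fine_ge0 (f_ge0 x).
have EZ x : Z x -> E x = 0 by move=> Zx; rewrite /E indicE memNset ?mulr0//; apply.
have mE : measurable_fun setT E.
  apply: measurable_funM => //; apply: measurable_indic; exact: measurableC.
have RN : is_RN_derivative Q Qt E.
  split=> // A mA; have [_ _ ->] := RN0; last by [].
  apply: ge0_ae_eq_integral => //.
  - by apply/measurable_EFinP; exact: measurable_funTS.
  - by apply/measurable_EFinP; exact: measurable_funTS.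
  - by move=> x _; rewrite lee_fin; exact: fine_ge0 (f_ge0 x).
  - by move=> x _; rewrite lee_fin.
  - exists Z; split => // x /= nH; apply: contrapT => nZ; apply: nH => _.
    by rewrite /E indicE mem_set ?mulr1.
exists E; split => //.
  have [q0|q0] := eqVneq (Qt [set 0]) 0%E.
    by rewrite EZ//; right; rewrite q0 eqxx.
  have [_ _ QE] := RN; have := QE _ m0; rewrite integral_set1// => QE0.
  have := majorant_atom_le; rewrite QE0 -[leRHS]mul1e.
  by rewrite lee_pmul2r ?lee_fin// ?fin_num_measure// lt0e q0/=.
by exists set0; split => // x /= nH; apply: nH => x0 gx; rewrite EZ//; left.
Qed.

Lemma slope_version_U1 E : slope_version E -> U1 R E.
Proof.
move=> vE; have [[mE E0 _] E01 _] := vE; split => //.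
- exact: measurable_funTS.
- move=> x x0; apply/integrableP; split.
    by apply/measurable_EFinP; exact: measurable_funTS.
  under eq_integral do rewrite /= ger0_norm//.
  by rewrite (le_lt_trans (slope_version_integral_le vE x0))// ltry.
- by move=> x x0; have := slope_version_integral_le vE x0.
Qed.

End least_concave_majorant.

(** * Members of [U1] as e-values *)

Lemma integral_U1_sublevel (R : realType) (E : R -> R) (I : set R) :
  measurable_fun setT E -> (forall x, 0 <= E x) -> U1 R E ->
  measurable I -> I `<=` `]0%R, +oo[%classic -> has_ubound I ->
  (forall x y, 0 < x -> x <= y -> I y -> I x) ->
  (\int[@lebesgue_measure R]_(x in I) (E x)%:E <= @lebesgue_measure R I)%E.
Proof.
move=> mE E0 [_ _ _ E1 _] mI ID ubI dI.
have [->|I0] := eqVneq I set0; first by rewrite integral_set0.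
have supI : has_sup I by split => //; exact/set0P.
have a0 : 0 <= sup I.
  have [y Iy] := supI.1; apply: le_trans (sup_upper_bound supI Iy).
  by have := ID y Iy; rewrite /= in_itv/= andbT => /ltW.
apply: (@le_trans _ _ (\int[@lebesgue_measure R]_(x in `[0%R, sup I]) (E x)%:E)%E).
  apply: ge0_subset_integral => //.
  - by apply/measurable_EFinP; exact: measurable_funTS.
  - by move=> x _; rewrite lee_fin.
  - move=> x Ix; rewrite /= in_itv/= (sup_upper_bound supI Ix) andbT.
    by have := ID x Ix; rewrite /= in_itv/= andbT => /ltW.
apply: le_trans (E1 _ a0) _.
apply: (@le_trans _ _ (@lebesgue_measure R `]0%R, sup I[%classic)).
  rewrite lebesgue_measure_itv/= lte_fin.
  by case: ltgtP a0 => // [_ _|<- _]; rewrite ?oppr0 ?adde0.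
apply: (@le_measure _ _ _ (@lebesgue_measure R)); rewrite ?inE//.
move=> x; rewrite /= in_itv/= => /andP[x0 xs].
have [y Iy xy] : exists2 y, I y & x < y.
  have e0 : 0 < sup I - x by rewrite subr_gt0.
  have [y Iy] := sup_adherent e0 supI; rewrite subKr => xy; by exists y.
exact: dI x0 (ltW xy) Iy.
Qed.

(** The atom at 0 is handled by [E 0 <= 1]. On ]0, +oo[ the layers of the monotone density of [P]
    are bounded initial segments, lying between ]0, a[ and [0, a] with [a] the supremum, so the
    defining bound of [U1] applies to each. *)
Lemma U1_evalue (R : realType) (E : R -> R) :
  measurable_fun setT E -> (forall x, 0 <= E x) -> U1 R E ->
  evalue (U0p R) E.
Proof.
move=> mE E0 EU1; have [_ _ _ _ E01] := EU1; split => // P [P0 Pc].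
pose h := right_slope (CDF P).
have hP : monotone_density P h by exact: monotone_density_right_slope.
have [mh h0 hN hni PE] := hP.
pose w : R -> R := \1_(`]0%R, +oo[%classic).
have w0 y : 0 <= w y by [].
have wN y : y <= 0 -> w y = 0.
  by move=> y0; rewrite /w indicE memNset//= in_itv/= andbT ltNge y0.
have mw : measurable_fun setT w by exact: measurable_indic.
have m0 : measurable ([set 0] : set (measurableTypeR R)) by exact: measurable_set1.
have mEw : measurable_fun setT (fun x => E x * w x) by exact: measurable_funM.
pose v : R -> R := \1_[set 0].
have mv : measurable_fun setT v by exact: measurable_indic.
have -> : (\int[P]_x (E x)%:E =
    \int[P]_x (E 0 * v x)%:E + \int[P]_x (E x * w x)%:E)%E.
  rewrite -ge0_integralD//.
  - apply: ge0_ae_eq_integral => //.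
    + exact/measurable_EFinP.
    + by apply: emeasurable_funD; apply/measurable_EFinP => //; exact: measurable_funM.
    + by move=> x _; rewrite lee_fin.
    + by move=> x _; rewrite adde_ge0// lee_fin mulr_ge0.
    + exists `]-oo, 0[%classic; split => // x /= nH.
      rewrite in_itv/= ltNge; apply/negP; rewrite le_eqVlt => x0; apply: nH => _.
      rewrite /v /w !indicE -EFinD; congr EFin.
      case/predU1P: x0 => [<-|x0].
        by rewrite mem_set// memNset/= ?in_itv/= ?ltxx// mulr1 mulr0 addr0.
      rewrite memNset/=; last by move=> x00; move: x0; rewrite x00 ltxx.
      by rewrite mem_set/= ?in_itv/= ?x0// mulr0 add0r mulr1.
  - by move=> x _; rewrite lee_fin mulr_ge0.
  - by apply/measurable_EFinP; exact: measurable_funM.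
  - by move=> x _; rewrite lee_fin mulr_ge0.
  - exact/measurable_EFinP.
have Pw : (\int[P]_x (E x * w x)%:E <= P `]0%R, +oo[%classic)%E.
  rewrite (integral_monotone_density hP)//; last 2 first.
  - by move=> x; rewrite mulr_ge0.
  - by move=> x x0; rewrite wN// mulr0.
  rewrite (_ : P _ = \int[P]_x (w x)%:E)%E; last by rewrite integral_indic// setIT.
  rewrite (integral_monotone_density hP)//.
  under eq_integral do rewrite mulrC EFinM.
  under [leRHS]eq_integral do rewrite mulrC EFinM.
  apply: layer_cake_le => //; do ?[exact/measurable_EFinP].
  - by move=> x; rewrite lee_fin mulr_ge0.
  move=> s s0.
  have mI : measurable [set x | s < h x] by exact: measurable_superlevel.
  have ID : [set x | s < h x] `<=` `]0%R, +oo[%classic.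
    move=> x /= sx; rewrite in_itv/= andbT ltNge; apply/negP => /hN hx.
    by move: sx; rewrite hx ltNge ltW.
  have wI x : s < h x -> w x = 1 by move=> /ID xD; rewrite /w indicE mem_set.
  have -> : (\int[@lebesgue_measure R]_(x in [set x | (s < h x)%R]) (E x * w x)%:E =
      \int[@lebesgue_measure R]_(x in [set x | (s < h x)%R]) (E x)%:E)%E.
    by apply: eq_integral => x; rewrite inE/= => /wI ->; rewrite mulr1.
  have -> : (\int[@lebesgue_measure R]_(x in [set x | (s < h x)%R]) (w x)%:E =
      \int[@lebesgue_measure R]_(x in [set x | (s < h x)%R]) 1)%E.
    by apply: eq_integral => x; rewrite inE/= => /wI ->.
  rewrite integral_cst// mul1e; apply: integral_U1_sublevel => //.
    (* Concavity gives [h x * x <= CDF P x - CDF P 0 <= 1], so [s < h x] forces [x <= s^-1]. *)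
    exists s^-1 => x /= sx.
    have : 0 < x by have := ID x sx; rewrite /= in_itv/= andbT.
    move=> x0; have := right_slope_le Pc (lexx 0) x0; rewrite subr0 -/(h x) => hx.
    rewrite -(ler_pM2r s0) mulVf ?gt_eqF//.
    move: hx; rewrite ler_pdivlMr// => hx.
    apply: (@le_trans _ _ (h x * x)); first by rewrite mulrC ler_pM2r// ltW.
    by apply: le_trans hx _; have := CDF_le1 P x; have := CDF_ge0 P 0; lra.
  by move=> x y x0 xy /= sy; apply: lt_le_trans sy _; exact: hni.
apply: (@le_trans _ _ (P [set 0%R] + P `]0%R, +oo[%classic)%E).
  apply: leeD => //; rewrite (_ : P _ = \int[P]_x (v x)%:E)%E; last first.
    by rewrite integral_indic// setIT.
  apply: ge0_le_integral => //.
  - by move=> x _; rewrite lee_fin mulr_ge0.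
  - by apply/measurable_EFinP; exact: measurable_funM.
  - exact/measurable_EFinP.
  - by move=> x _; rewrite lee_fin -[leRHS]mul1r ler_wpM2r.
have <- : (P setT = P [set 0%R] + P `]0%R, +oo[%classic)%E.
  by rewrite [LHS](halfline_decomp P0)//; congr (P _ + P _)%E; rewrite setTI.
exact: probability_le1.
Qed.

(** * Filtrations and independence *)

Section rectangles.
Context d (T : measurableType d) (R : realType) (n : nat).

(** The sides form an infinite sequence, so that appending a side only changes [n], and the format
    matches that of [iid_under]. *)
Definition rectangle (A : nat -> set T) : set (n.-tuple T) :=
  [set x | forall i : 'I_n, A i (tnth x i)].

Lemma measurable_rectangle A : (forall i, measurable (A i)) ->
  measurable (rectangle A).
Proof.
move=> mA; rewrite (_ : rectangle A =
    \big[setI/setT]_(i < n) ((@tnth n T)^~ i @^-1` A i)).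
  apply: bigsetI_measurable => i _.
  by rewrite -[X in measurable X]setTI; exact: measurable_tnth.
rewrite -bigcap_seq; apply/seteqP; split => x /= xA.
  by move=> i _; exact: xA.
by move=> i; apply: xA; rewrite /= mem_index_enum.
Qed.

Lemma rectangle_measure_unique (m1 m2 : {measure set (n.-tuple T) -> \bar R}) :
  (m1 setT < +oo)%E ->
  (forall A, (forall i, measurable (A i)) -> m1 (rectangle A) = m2 (rectangle A)) ->
  forall B, measurable B -> m1 B = m2 B.
Proof.
move=> m1oo m12.
pose G := [set rectangle A | A in [set A : nat -> set T | forall i, measurable (A i)]].
have GT : G setT.
  by exists (fun=> setT) => //; apply/seteqP; split.
apply: (measure_unique G (fun=> setT)) => //.
- apply/seteqP; split.
    apply: smallest_sub; first exact: smallest_sigma_algebra.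
    move=> B; rewrite -bigcup_seq => -[/= i _ [A mA <-]].
    apply: sub_sigma_algebra; exists (fun k : nat => if k == i :> nat then A else setT).
      by move=> k /=; case: ifP.
    apply/seteqP; split => x /=.
      by move=> /(_ i); rewrite eqxx.
    move=> [_ xA] k; case: ifPn => // /eqP ki.
    by have -> : k = i by exact: val_inj.
  apply: smallest_sub; first exact: sigma_algebra_measurable.
  by move=> _ [A mA <-]; exact: measurable_rectangle.
- move=> _ _ [A mA <-] [B mB <-]; exists (fun i => A i `&` B i).
    by move=> i; exact: measurableI.
  by apply/seteqP; split => x /=;
    [move=> h; split => i; have [] := h i|move=> [hA hB] i; split].
- by rewrite bigcup_const//; exists 0%N.
- by move=> _ [A mA <-]; exact: m12.
Qed.

End rectangles.
Arguments rectangle {d T} n A.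

Lemma mpower_rectangle d (T : measurableType d) (R : realType)
    (m : {finite_measure set T -> \bar R}) n (A : nat -> set T) :
  (forall i, measurable (A i)) ->
  mpower m n (rectangle n A) = (\prod_(i < n) m (A i))%E.
Proof.
elim: n A => [|n IH] A mA.
  by rewrite big_ord0 /= diracE mem_set// => -[].
rewrite big_ord_recl -(IH (fun i => A i.+1))//.
transitivity ((m \x mpower m n)%E (A 0%N `*` rectangle n (fun i => A i.+1)));
  last first.
  by rewrite product_measure1E//; exact: measurable_rectangle.
congr ((m \x mpower m n)%E _); apply/seteqP; split => -[x y] /=.
  move=> h; split; first exact: (h ord0).
  by move=> i; have := h (lift ord0 i); rewrite tnthS.
move=> [Ax hy] i; have [j ->|->] := unliftP ord0 i; last exact: Ax.
by rewrite tnthS; exact: hy.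
Qed.

Section observations.
Context d d' (T : measurableType d) (Omega : measurableType d') (R : realType).
Variable X : nat -> {mfun Omega >-> T}.

Definition observed n (w : Omega) : n.-tuple T := [tuple X i w | i < n].

Lemma measurable_observed n : measurable_fun setT (observed n).
Proof.
apply/measurable_fun_tnthP => i.
rewrite (_ : _ \o _ = X i)//.
by apply/funext => w /=; rewrite tnth_mktuple.
Qed.

Lemma observed_preimage n (B : set (n.-tuple T)) : measurable B ->
  measurable (observed n @^-1` B).
Proof. by move=> mB; rewrite -[X in measurable X]setTI; exact: measurable_observed. Qed.

Lemma natural_filtrationP n (A : set Omega) :
  natural_filtration X n A <-> exists2 B, measurable B & A = observed n @^-1` B.
Proof.
rewrite /natural_filtration.
have -> : (fun i : 'I_n => (X i : Omega -> T)) =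
    (fun i => (fun x : n.-tuple T => tnth x i) \o observed n).
  by apply/funext => i; apply/funext => w /=; rewrite tnth_mktuple.
rewrite g_sigma_preimage_comp; split => [[B mB <-]|[B mB ->]].
  by exists B => //; rewrite setTI.
by exists B => //; rewrite setTI.
Qed.

Lemma natural_filtration_measurable n A : natural_filtration X n A -> measurable A.
Proof. by move=> /natural_filtrationP[B mB ->]; exact: observed_preimage. Qed.

Lemma natural_filtrationS n : natural_filtration X n `<=` natural_filtration X n.+1.
Proof.
apply: smallest_sub; first exact: smallest_sigma_algebra.
move=> A; rewrite -bigcup_seq => -[/= i _ [B mB <-]].
apply: sub_sigma_algebra; rewrite -bigcup_seq.
exists (widen_ord (leqnSn n) i); first by rewrite /= mem_index_enum.
by exists B.
Qed.

Lemma natural_filtrationC n A : natural_filtration X n A ->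
  natural_filtration X n (~` A).
Proof. exact: sigma_algebraC. Qed.

Lemma natural_filtrationI n A B : natural_filtration X n A ->
  natural_filtration X n B -> natural_filtration X n (A `&` B).
Proof.
move=> /natural_filtrationP[A' mA' ->] /natural_filtrationP[B' mB' ->].
by apply/natural_filtrationP; exists (A' `&` B') => //; exact: measurableI.
Qed.

Lemma measurable_wrt_observed n (h : n.-tuple T -> R) :
  measurable_fun setT h -> measurable_wrt (natural_filtration X n) (h \o observed n).
Proof.
move=> mh B mB; apply/natural_filtrationP; exists (h @^-1` B) => //.
by rewrite -[X in measurable X]setTI; exact: mh.
Qed.

Lemma measurable_wrt_fun n (f : Omega -> R) :
  measurable_wrt (natural_filtration X n) f -> measurable_fun setT f.
Proof.
move=> Ff _ B mB; rewrite setTI.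
exact: natural_filtration_measurable (Ff _ mB).
Qed.

Lemma measurable_wrt_superlevel n (f : Omega -> R) s :
  measurable_wrt (natural_filtration X n) f ->
  natural_filtration X n [set w | s < f w].
Proof.
move=> /(_ `]s, +oo[%classic (measurable_itv _)).
by rewrite (_ : _ @^-1` _ = [set w | s < f w])//; apply/seteqP; split => w /=;
  rewrite in_itv/= andbT.
Qed.

Variables (Pr : probability Omega R) (P : probability T R).
Hypothesis iid : iid_under X Pr P.

Lemma observed_rectangle n (A : nat -> set T) :
  observed n @^-1` rectangle n A = \bigcap_(i < n) (X i @^-1` A i).
Proof.
apply/seteqP; split => w /= h; first by move=> i /= ni; have := h (Ordinal ni);
  rewrite tnth_mktuple.
by move=> i; rewrite tnth_mktuple; apply: h; exact: ltn_ord.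
Qed.

Lemma iid_rectangle n (A : nat -> set T) : (forall i, measurable (A i)) ->
  Pr (observed n @^-1` rectangle n A) = (\prod_(i < n) P (A i))%E.
Proof.
move=> mA; have [law indep] := iid.
have In : `I_n = [set` iota 0 n].
  by apply/seteqP; split => i; rewrite /= mem_iota add0n.
rewrite observed_rectangle In indep ?iota_uniq//.
rewrite -[n in iota 0 n]subn0 -/(index_iota 0 n) big_mkord.
by apply: eq_bigr => i _; exact: law.
Qed.

Lemma iid_observed n (B : set (n.-tuple T)) : measurable B ->
  Pr (observed n @^-1` B) = ppower P n B.
Proof.
apply: (@rectangle_measure_unique _ _ _ _ (pushforward Pr (observed n)) (mpower P n)).
- exact: measurable_observed.
- move=> ?; change (Pr (observed n @^-1` setT) < +oo)%E.
  rewrite preimage_setT; apply: (@le_lt_trans _ _ 1%E); last exact: ltry.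
  exact: probability_le1.
- move=> ? A mA; transitivity (\prod_(i < n) P (A i))%E; first exact: iid_rectangle.
  exact/esym/mpower_rectangle.
Qed.

End observations.

Section independence.
Context d d' (T : measurableType d) (Omega : measurableType d') (R : realType).
Variable X : nat -> {mfun Omega >-> T}.
Variables (Pr : probability Omega R) (P : probability T R).
Hypothesis iid : iid_under X Pr P.
Local Notation F := (natural_filtration X).
Local Open Scope ereal_scope.

(** For fixed [C] both sides are finite measures in the tuple event [B], so rectangles suffice;
    there [C] becomes one more side, of index [n]. *)
Lemma iid_indep n A (C : set T) : F n A -> measurable C ->
  Pr (A `&` X n @^-1` C) = Pr A * P C.
Proof.
move=> /natural_filtrationP[B mB ->] mC.
have mX : measurable (X n @^-1` C) by exact: measurable_funPTI.
have PC0 : (0 <= fine (P C))%R by exact: fine_ge0.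
have PCE : (fine (P C))%:E = P C by rewrite fineK// fin_num_measure.
rewrite muleC -PCE.
change (mrestr Pr mX (observed X n @^-1` B) =
  mscale (NngNum PC0) Pr (observed X n @^-1` B)).
have mO : measurable_fun setT (observed X n) by exact: measurable_observed.
apply: (@rectangle_measure_unique _ _ _ _
  (pushforward (mrestr Pr mX) (observed X n))
  (pushforward (mscale (NngNum PC0) Pr) (observed X n))) => //.
- apply: (@le_lt_trans _ _ 1%E); last exact: ltry.
  apply: probability_le1; rewrite preimage_setT setTI; exact: mX.
- move=> A' mA'.
  change (Pr (observed X n @^-1` rectangle n A' `&` X n @^-1` C) =
    (fine (P C))%:E * Pr (observed X n @^-1` rectangle n A')).
  rewrite (iid_rectangle iid)// PCE.
  pose A'' k := if (k < n)%N then A' k else C.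
  have -> : observed X n @^-1` rectangle n A' `&` X n @^-1` C =
      observed X n.+1 @^-1` rectangle n.+1 A''.
    rewrite !observed_rectangle; apply/seteqP; split => w /=.
      move=> [h hC] i /=; rewrite ltnS leq_eqVlt => /predU1P[->|ni].
        by rewrite /A'' ltnn.
      by rewrite /A'' ni; exact: h.
    move=> h; split => [i /= ni|].
      by have := h i; rewrite /A'' /= ni; apply; exact: ltnW.
    by have := h n; rewrite /A'' ltnn; apply; exact: ltnSn.
  rewrite (iid_rectangle iid); last by move=> i; rewrite /A''; case: ifP.
  rewrite big_ord_recr/= muleC /A'' ltnn; congr (_ * _).
  by apply: eq_bigr => i _; rewrite ltn_ord.
Qed.

Lemma iid_integral_set n A (h : T -> R) : F n A ->
  measurable_fun setT h -> (forall x, 0 <= h x)%R ->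
  \int[Pr]_(w in A) (h (X n w))%:E = Pr A * \int[P]_x (h x)%:E.
Proof.
move=> FA mh h0; have mA := natural_filtration_measurable FA.
have mhX : measurable_fun setT (fun w => h (X n w)) by exact: measurableT_comp.
transitivity (\int[Pr]_w ((h (X n w))%:E * (\1_A w)%:E)).
  rewrite integral_mkcond; apply: eq_integral => w _.
  by rewrite patchE indicE; case: ifPn => _; rewrite ?mule1 ?mule0.
rewrite muleC -ge0_integralZr//; last 2 first.
- exact/measurable_EFinP.
- by move=> x _; rewrite lee_fin.
apply: layer_cake_eq => //.
- by apply/measurable_EFinP; exact: measurable_indic.
move=> s s0; have mS := measurable_superlevel s mh.
have mSX := measurable_superlevel s mhX.
by rewrite integral_cst// integral_indic//; exact: (iid_indep FA mS).
Qed.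

(** Independence is only needed for events: the layers of [h] were treated in [iid_integral_set],
    and the layers of [f] belong to [F n]. *)
Lemma iid_integral n (f : Omega -> R) (h : T -> R) :
  measurable_wrt (F n) f -> (forall w, 0 <= f w)%R ->
  measurable_fun setT h -> (forall x, 0 <= h x)%R ->
  \int[Pr]_w (f w * h (X n w))%:E = \int[Pr]_w (f w)%:E * \int[P]_x (h x)%:E.
Proof.
move=> Ff f0 mh h0; have mf := measurable_wrt_fun Ff.
have mhX : measurable_fun setT (fun w => h (X n w)) by exact: measurableT_comp.
have c0 : 0 <= \int[P]_x (h x)%:E by apply: integral_ge0 => x _; rewrite lee_fin.
rewrite -ge0_integralZr//; last 2 first.
- exact/measurable_EFinP.
- by move=> x _; rewrite lee_fin.
under [LHS]eq_integral do rewrite EFinM.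
apply: layer_cake_eq => //; first exact/measurable_EFinP.
  by move=> w; rewrite lee_fin.
move=> s s0; have FS := measurable_wrt_superlevel s Ff.
rewrite iid_integral_set// integral_cst; last exact: measurable_superlevel.
by rewrite muleC.
Qed.

End independence.

(** * The likelihood product as a supermartingale *)

Section likelihood_process.
Context d d' (T : measurableType d) (Omega : measurableType d') (R : realType).
Variable X : nat -> {mfun Omega >-> T}.
Variables (E : T -> R) (mE : measurable_fun setT E) (E0 : forall x, 0 <= E x).
Local Notation F := (natural_filtration X).
Let M n w := \prod_(i < n) E (X i w).

Lemma prod_observed n w : M n w = \prod_(i < n) E (tnth (observed X n w) i).
Proof. by apply: eq_bigr => i _; rewrite tnth_mktuple. Qed.

Let M0 n w : 0 <= M n w. Proof. exact: prodr_ge0. Qed.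

Lemma adapted_prod : adapted X M.
Proof.
move=> n; rewrite (_ : M n = (fun x : n.-tuple T => \prod_(i < n) E (tnth x i)) \o observed X n).
  by apply: measurable_wrt_observed; exact: measurable_prod_tnth.
by apply/funext => w; rewrite prod_observed.
Qed.

Variables (Pr : probability Omega R) (P : probability T R).
Hypothesis iid : iid_under X Pr P.
Hypothesis E1 : (\int[P]_x (E x)%:E <= 1)%E.

Lemma integral_prod_le1 n : (\int[Pr]_w (M n w)%:E <= 1)%E.
Proof.
elim: n => [|n IH].
  under eq_integral do rewrite /M big_ord0.
  by rewrite integral_cst// mul1e probability_le1.
under eq_integral do rewrite /M big_ord_recr.
rewrite /= (iid_integral iid (@adapted_prod n))//.
apply: (@le_trans _ _ (1 * 1)%E); last by rewrite mule1.
by apply: lee_pmul => //; apply: integral_ge0 => ? _; rewrite lee_fin.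
Qed.

(** By independence the conditional expectation of the next product is [c] times the current one,
    where [c <= 1] is the integral of [E] under [P]. *)
Lemma supermartingale_prod : supermartingale X Pr M.
Proof.
have iM n : Pr.-integrable setT (EFin \o M n).
  apply/integrableP; split.
    by apply/measurable_EFinP; exact: measurable_wrt_fun (@adapted_prod n).
  under eq_integral do rewrite /= ger0_norm//.
  by rewrite (le_lt_trans (integral_prod_le1 n))// ltry.
split => //; first exact: adapted_prod.
move=> n; pose c := fine (\int[P]_x (E x)%:E)%E.
have cE : (\int[P]_x (E x)%:E)%E = c%:E.
  rewrite fineK// fin_real//; apply/andP; split;
    last by rewrite (le_lt_trans E1)// ltry.
  by rewrite (lt_le_trans (ltNyr 0))// integral_ge0// => x _; rewrite lee_fin.
have c0 : 0 <= c by rewrite fine_ge0// integral_ge0// => x _; rewrite lee_fin.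
have FM := @adapted_prod n; have mM := measurable_wrt_fun FM.
exists (fun w => M n w * c); split; last first.
  apply/aeW => w; rewrite -[leRHS]mulr1 ler_wpM2l//.
  by rewrite -lee_fin -cE.
split.
- rewrite (_ : (fun w => _) =
    (fun x : n.-tuple T => \prod_(i < n) E (tnth x i) * c) \o observed X n).
    apply: measurable_wrt_observed; apply: measurable_funM => //.
    exact: measurable_prod_tnth.
  by apply/funext => w; rewrite prod_observed.
- have := integrableZr measurableT c (iM n).
  by apply: eq_integrable => // w _; rewrite /= EFinM.
- move=> A FA; have mA := natural_filtration_measurable FA.
  have [B mB AB] := (natural_filtrationP _ _ _).1 FA.
  pose f w := M n w * \1_A w.
  have Ff : measurable_wrt (F n) f.
    rewrite (_ : f = (fun x : n.-tuple T => \prod_(i < n) E (tnth x i) * \1_B x) \o observed X n).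
      apply: measurable_wrt_observed; apply: measurable_funM;
        last exact: measurable_indic.
      exact: measurable_prod_tnth.
    by apply/funext => w; rewrite /f prod_observed AB.
  have f0 w : 0 <= f w by rewrite mulr_ge0.
  have patchA (k : Omega -> R) :
      (\int[Pr]_(w in A) (k w)%:E = \int[Pr]_w (k w * \1_A w)%:E)%E.
    rewrite integral_mkcond; apply: eq_integral => w _.
    by rewrite patchE indicE; case: ifPn => _; rewrite ?mulr1 ?mulr0.
  rewrite !patchA.
  transitivity (\int[Pr]_w (f w * E (X n w))%:E)%E; last first.
    by apply: eq_integral => w _; congr EFin; rewrite /f /M big_ord_recr/= mulrAC.
  rewrite (iid_integral iid Ff)// cE -ge0_integralZr//.
  + by apply: eq_integral => w _; rewrite -EFinM /f mulrAC.
  + by apply/measurable_EFinP; exact: measurable_wrt_fun Ff.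
  + by move=> w _; rewrite lee_fin.
Qed.

End likelihood_process.

(** * Stopping *)

(** Continuity from below of the measure with density [f]. It is applied to the events [{tau <= n}],
    outside whose union stopped processes are 0 by convention. *)
Lemma integral_exhaustion_le d (T : measurableType d) (R : realType)
    (mu : {measure set T -> \bar R}) (f : T -> R) (S : (set T)^nat) (c : \bar R) :
  (forall n, measurable (S n)) -> nondecreasing_seq S ->
  measurable_fun setT f -> (forall x, 0 <= f x) ->
  (forall x, (forall n, ~ S n x) -> f x = 0) ->
  (forall n, \int[mu]_(x in S n) (f x)%:E <= c)%E ->
  (\int[mu]_x (f x)%:E <= c)%E.
Proof.
move=> mS S_nd mf f0 fS le_c.
pose nu := density_measure mu mf f0.
have mU : measurable (\bigcup_n S n) by exact: bigcupT_measurable.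
have -> : (\int[mu]_x (f x)%:E = nu (\bigcup_n S n))%E.
  rewrite /nu /density_measure [RHS]integral_mkcond; apply: eq_integral => x _.
  rewrite patchE; case: ifPn => //; rewrite notin_setE => nSx.
  by rewrite fS// => n Sn; apply: nSx; exists n.
have cvgS : nu (S n) @[n --> \oo] --> nu (\bigcup_n S n) by exact: nondecreasing_cvg_mu.
rewrite -(cvg_lim _ cvgS)//; apply: lime_le; first by apply/cvg_ex; eexists;
  exact: cvgS.
by apply: nearW => n; exact: le_c.
Qed.

Section stopping.
Context d d' (T : measurableType d) (Omega : measurableType d') (R : realType).
Variable X : nat -> {mfun Omega >-> T}.
Local Notation F := (natural_filtration X).
Variable tau : Omega -> option nat.
Hypothesis tauF : stopping_time X tau.

Definition stopped_by n : set Omega := [set w | exists2 k, tau w = Some k & (k <= n)%N].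
Local Notation S := stopped_by.
Local Notation L n := [set w | tau w = Some n].

Lemma stopped_byS n : S n.+1 = S n `|` L n.+1.
Proof.
apply/seteqP; split => w /=.
  move=> [k wk]; rewrite leq_eqVlt ltnS => /predU1P[<-|kn]; first by right.
  by left; exists k.
by move=> [[k wk kn]|wn]; [exists k => //; exact: leqW|exists n.+1].
Qed.

Lemma stopped_by0 : S 0 = L 0.
Proof.
apply/seteqP; split => w /=; last by move=> w0; exists 0%N.
by move=> [k wk]; rewrite leqn0 => /eqP k0; rewrite wk k0.
Qed.

Lemma disjoint_stopped_by n : S n `&` L n.+1 = set0.
Proof.
apply/seteqP; split => w //= -[[k wk kn] wn]; move: wk; rewrite wn => -[nk].
by move: kn; rewrite -nk ltnn.
Qed.

Lemma stopping_time_eqF n : F n (L n).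
Proof.
case: n => [|n]; first by rewrite -stopped_by0; exact: tauF.
have -> : L n.+1 = S n.+1 `&` ~` S n.
  rewrite stopped_byS setIUl setICr set0U; apply/esym/setIidl => w Lw Sw.
  by rewrite -[False]/(set0 w) -(disjoint_stopped_by n).
apply: natural_filtrationI; first exact: tauF.
by apply: natural_filtrationS; apply: natural_filtrationC; exact: tauF.
Qed.

Lemma measurable_stopped_by n : measurable (S n).
Proof. exact: natural_filtration_measurable (@tauF n). Qed.

Let mL n : measurable (L n).
Proof. exact: natural_filtration_measurable (@stopping_time_eqF n). Qed.

Lemma nondecreasing_stopped_by : nondecreasing_seq S.
Proof.
move=> n m nm; apply/subsetPset => w [k wk kn]; exists k => //.
exact: leq_trans nm.
Qed.

Lemma measurable_stopped (g : nat -> Omega -> R) :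
  (forall n, measurable_fun setT (g n)) -> measurable_fun setT (stopped g tau).
Proof.
move=> mg; have mU : measurable (\bigcup_n L n) by exact: bigcupT_measurable.
rewrite -(setUv (\bigcup_n L n)); apply/measurable_funU => //; first exact: measurableC.
split.
  apply/measurable_fun_bigcup => // n.
  apply: (eq_measurable_fun (g n)); last exact: measurable_funTS.
  by move=> w; rewrite inE /stopped /= => ->.
apply: (eq_measurable_fun (cst 0 : Omega -> R)) => // w; rewrite inE /stopped /= => nL.
by case tw : (tau w) => [n|//]; exfalso; apply: nL; exists n.
Qed.

Lemma stoppedE (g : nat -> Omega -> R) n w : L n w -> stopped g tau w = g n w.
Proof. by rewrite /stopped /= => ->. Qed.

Lemma stopped_out (g : nat -> Omega -> R) w :
  (forall n, ~ S n w) -> stopped g tau w = 0.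
Proof.
by move=> nS; rewrite /stopped; case tw : (tau w) => [n|//]; case: (nS n); exists n.
Qed.

Lemma ge0_integral_stopped_byS (mu : {measure set Omega -> \bar R})
    (f : Omega -> R) n :
  measurable_fun setT f -> (forall w, 0 <= f w) ->
  (\int[mu]_(w in S n.+1) (f w)%:E =
   \int[mu]_(w in S n) (f w)%:E + \int[mu]_(w in L n.+1) (f w)%:E)%E.
Proof.
move=> mf f0; rewrite stopped_byS ge0_integral_setU//.
- exact: measurable_stopped_by.
- by apply/measurable_EFinP; exact: measurable_funTS.
- by move=> w _; rewrite lee_fin.
- by apply/disj_setPS; rewrite disjoint_stopped_by.
Qed.

Variables (Pr : probability Omega R) (g : nat -> Omega -> R).
Hypothesis g0 : forall n w, 0 <= g n w.

Lemma supermartingale_integral_le n A : supermartingale X Pr g -> F n A ->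
  (\int[Pr]_(w in A) (g n.+1 w)%:E <= \int[Pr]_(w in A) (g n w)%:E)%E.
Proof.
move=> [ga gi gs] FA; have mA := natural_filtration_measurable FA.
have [Z [[FZ iZ ZE] Zg]] := gs n.
have mZ := measurable_wrt_fun FZ; have mg := measurable_wrt_fun (ga n).
rewrite -ZE//.
(* [Z] is not known to be nonnegative. Its positive part is still almost surely below [g n], which
   is nonnegative, and it fits the comparison of nonnegative functions. *)
apply: (@le_trans _ _ (\int[Pr]_(w in A) (Num.max (Z w) 0)%:E)%E).
  apply: le_integral => //.
  - exact: integrableS iZ.
  - rewrite (_ : (fun w => _) = (EFin \o Z)^\+)%E.
      by apply: (integrableS measurableT) => //; exact: integrable_funepos.
    by apply/funext => w; rewrite funeposE/= -EFin_max.
  - by move=> w _; rewrite lee_fin le_max lexx.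
apply: ae_ge0_le_integral => //.
- by move=> w _; rewrite lee_fin le_max lexx orbT.
- by apply/measurable_EFinP; apply: measurable_funTS; exact: measurable_maxr.
- by move=> w _; rewrite lee_fin.
- by apply/measurable_EFinP; exact: measurable_funTS.
- have [N [mN N0 sub]] := Zg; exists N; split => // w /= nH; apply: sub => /= Zw.
  by apply: nH => _; rewrite lee_fin ge_max Zw g0.
Qed.

Lemma supermartingale_stopped_le n : supermartingale X Pr g ->
  (\int[Pr]_w (g 0%N w)%:E <= 1)%E ->
  (\int[Pr]_(w in S n) (stopped g tau w)%:E <= 1)%E.
Proof.
move=> sg g01; have [ga _ _] := sg.
have mg k : measurable_fun setT (g k) by exact: measurable_wrt_fun (ga k).
have mst := measurable_stopped mg.
have st0 w : 0 <= stopped g tau w by rewrite /stopped; case: (tau w).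
have onL k : (\int[Pr]_(w in L k) (stopped g tau w)%:E =
              \int[Pr]_(w in L k) (g k w)%:E)%E.
  by apply: eq_integral => w; rewrite inE => /stoppedE ->.
have mSC k : measurable (~` S k) by apply: measurableC; exact: measurable_stopped_by.
have splitU k (A B : set Omega) : measurable A -> measurable B -> A `&` B = set0 ->
    (\int[Pr]_(w in A `|` B) (g k w)%:E =
     \int[Pr]_(w in A) (g k w)%:E + \int[Pr]_(w in B) (g k w)%:E)%E.
  move=> mA mB AB; rewrite ge0_integral_setU//.
  - by apply/measurable_EFinP; exact: measurable_funTS.
  - by move=> w _; rewrite lee_fin.
  - by apply/disj_setPS; rewrite AB.
(* Stronger invariant: what has been stopped by time [n] plus what is still running is at most 1.
   The running part does not increase on the event [~ S n] of [F n], and its share on [L n.+1] then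
   moves to the stopped part. *)
suff : (\int[Pr]_(w in S n) (stopped g tau w)%:E +
        \int[Pr]_(w in ~` S n) (g n w)%:E <= 1)%E.
  apply: le_trans; rewrite leeDl// integral_ge0// => w _.
  by rewrite lee_fin.
elim: n => [|n IH].
  rewrite [in X in (X + _)%E]stopped_by0 onL -splitU//.
  - by rewrite -stopped_by0 setUv.
  - by rewrite -stopped_by0 setICr.
rewrite ge0_integral_stopped_byS// onL -addeA -splitU//; last first.
  by apply/seteqP; split => w //= -[Lw]; apply; exists n.+1.
rewrite (_ : L n.+1 `|` ~` S n.+1 = ~` S n).
  apply: le_trans IH; apply: leeD => //.
  by apply: supermartingale_integral_le => //; apply: natural_filtrationC; exact: tauF.
rewrite stopped_byS setCU setUIr setUv setIT; apply/setUidr => w Lw Sw.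
by rewrite -[False]/(set0 w) -(disjoint_stopped_by n).
Qed.

End stopping.

(** * Log-optimality of the likelihood process *)

Section optimality.
Context d d' (T : measurableType d) (Omega : measurableType d') (R : realType).
Variable X : nat -> {mfun Omega >-> T}.
Variables (Q Qt : probability T R) (Qa : {finite_measure set T -> \bar R}).
Variables (E : T -> R) (N : set T).
Hypothesis mE : measurable_fun setT E.
Hypothesis E0 : forall x, 0 <= E x.
Hypothesis QaQ : is_RN_derivative Qa Q (fun x => (E x)^-1).
Hypothesis QaQt : is_RN_derivative Qa Qt \1_N.
Variables (PrQ PrQt : probability Omega R).
Hypothesis iidQ : iid_under X PrQ Q.
Hypothesis iidQt : iid_under X PrQt Qt.
Local Notation F := (natural_filtration X).
Let M n w := \prod_(i < n) E (X i w).

Let M0 n w : 0 <= M n w. Proof. exact: prodr_ge0. Qed.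

Let mM n : measurable_fun setT (M n).
Proof.
have ad : adapted X M by exact: adapted_prod.
exact: measurable_wrt_fun (@ad n).
Qed.

Let mMV n : measurable_fun setT (fun w => (M n w)^-1).
Proof. exact: measurable_funV. Qed.

(** The inverse product is the density of the power of [Qa] with respect to that of [Q], and the
    power of [Qa] has density at most 1, a product of indicators, with respect to that of [Qt]. *)
Lemma integral_inv_prod_le n A : F n A ->
  (\int[PrQ]_(w in A) ((M n w)^-1)%:E <= PrQt A)%E.
Proof.
move=> /natural_filtrationP[B mB ->].
have mV : measurable_fun setT (fun x => (E x)^-1) by exact: measurable_funV.
pose h (x : n.-tuple T) := \prod_(i < n) (E (tnth x i))^-1.
have mh : measurable_fun setT h by exact: measurable_prod_tnth mV.
have [_ _ hE] := is_RN_derivative_mpower n QaQ.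
have [_ _ NE] := is_RN_derivative_mpower n QaQt.
have -> : (\int[PrQ]_(w in observed X n @^-1` B) ((M n w)^-1)%:E = mpower Qa n B)%E.
  rewrite hE//.
  transitivity (\int[pushforward PrQ (observed X n)]_(x in B) (h x)%:E)%E.
    rewrite ge0_integral_pushforward//.
    - apply: eq_integral => w _; congr EFin; rewrite /h /M /= prodfV.
      by congr (_^-1); exact: prod_observed.
    - exact: measurable_observed.
    - by apply/measurable_EFinP; exact: measurable_funTS.
    - by move=> x _; rewrite lee_fin; apply: prodr_ge0 => i _; rewrite invr_ge0.
  apply: eq_measure_integral; first exact: measurable_observed.
  by move=> ? C mC _; exact: (iid_observed iidQ mC).
rewrite NE// (iid_observed iidQt mB).
apply: (@le_trans _ _ (\int[mpower Qt n]_(x in B) 1)%E);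
  last by rewrite integral_cst// mul1e.
apply: ge0_le_integral => //.
- by move=> x _; rewrite lee_fin prodr_ge0.
- apply/measurable_EFinP; apply: measurable_funTS; apply: measurable_prod_tnth.
  by have [] := QaQt.
- move=> x _; rewrite lee_fin; apply: prodr_ile1 => i _.
  by rewrite indicE; case: (_ \in _); rewrite lexx ler01.
Qed.

Lemma integral_ratio_le n A (f : Omega -> R) : F n A ->
  measurable_wrt (F n) f -> (forall w, 0 <= f w) ->
  (\int[PrQ]_(w in A) (f w / M n w)%:E <= \int[PrQt]_(w in A) (f w)%:E)%E.
Proof.
move=> FA Ff f0; have mA := natural_filtration_measurable FA.
have mf := measurable_wrt_fun Ff.
pose k w := \1_A w * f w.
have k0 w : 0 <= k w by rewrite mulr_ge0.
have mk : measurable_fun setT k by apply: measurable_funM => //;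
  exact: measurable_indic.
have -> : (\int[PrQ]_(w in A) (f w / M n w)%:E =
    \int[PrQ]_w ((k w)%:E * ((M n w)^-1)%:E))%E.
  rewrite integral_mkcond; apply: eq_integral => w _; rewrite patchE -EFinM /k indicE.
  by case: ifPn => _; rewrite ?mul1r ?mul0r.
have -> : (\int[PrQt]_(w in A) (f w)%:E = \int[PrQt]_w ((k w)%:E * 1))%E.
  rewrite integral_mkcond; apply: eq_integral => w _; rewrite patchE mule1 /k indicE.
  by case: ifPn => _; rewrite ?mul1r ?mul0r.
apply: layer_cake_le => //.
- exact/measurable_EFinP.
- by move=> w; rewrite lee_fin invr_ge0.
move=> s s0.
have -> : [set w | s < k w] = A `&` [set w | s < f w].
  apply/seteqP; split => w /=; rewrite /k indicE.
    have [wA|wA] := boolP (w \in A); last by rewrite mul0r ltNge ltW.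
    by rewrite mul1r; split => //; rewrite inE in wA.
  by move=> [wA]; rewrite mem_set// mul1r.
have FAs : F n (A `&` [set w | s < f w]).
  by apply: natural_filtrationI => //; exact: measurable_wrt_superlevel.
rewrite integral_cst ?mul1e; first exact: integral_inv_prod_le.
exact: natural_filtration_measurable FAs.
Qed.

Variables (g : nat -> Omega -> R) (tau : Omega -> option nat).
Hypothesis g0 : forall n w, 0 <= g n w.
Hypothesis ga : adapted X g.
Hypothesis tauF : stopping_time X tau.
Local Notation S := (stopped_by tau).

(* [tau] may be infinite with positive probability under [Qt], so only the
   parts on [{tau <= n}] are compared, before [n] tends to infinity. *)
Lemma Elog_ratio_stopped :
  (forall n, \int[PrQt]_(w in S n) (stopped g tau w)%:E <= 1)%E ->
  Elog_ratio_le0 PrQ (stopped g tau) (stopped M tau).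
Proof.
move=> g1.
have mg n : measurable_fun setT (g n) by exact: measurable_wrt_fun (@ga n).
have msg := measurable_stopped tauF mg.
have msM := measurable_stopped tauF mM.
have sg0 w : 0 <= stopped g tau w by rewrite /stopped; case: (tau w).
have sM0 w : 0 <= stopped M tau w by rewrite /stopped; case: (tau w).
apply: Elog_ratio_le0_of_integral_le1 => //.
have mr : measurable_fun setT (fun w => stopped g tau w / stopped M tau w).
  by apply: measurable_funM => //; exact: measurable_funV.
have r0 w : 0 <= stopped g tau w / stopped M tau w by rewrite divr_ge0.
apply: (@integral_exhaustion_le _ _ _ _ _ S) => //.
- by move=> n; exact: measurable_stopped_by tauF n.
- exact: nondecreasing_stopped_by.
- by move=> w nS; rewrite stopped_out// mul0r.
move=> n; apply: le_trans (g1 n).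
have onL k : (\int[PrQ]_(w in [set w | tau w = Some k]) (stopped g tau w / stopped M tau w)%:E <=
    \int[PrQt]_(w in [set w | tau w = Some k]) (stopped g tau w)%:E)%E.
  have -> : (\int[PrQ]_(w in [set w | tau w = Some k]) (stopped g tau w / stopped M tau w)%:E =
      \int[PrQ]_(w in [set w | tau w = Some k]) (g k w / M k w)%:E)%E.
    by apply: eq_integral => w; rewrite inE => /= tw; rewrite !(stoppedE _ tw).
  have -> : (\int[PrQt]_(w in [set w | tau w = Some k]) (stopped g tau w)%:E =
      \int[PrQt]_(w in [set w | tau w = Some k]) (g k w)%:E)%E.
    by apply: eq_integral => w; rewrite inE => /= tw; rewrite !(stoppedE _ tw).
  by apply: integral_ratio_le => //; exact: stopping_time_eqF.
elim: n => [|n IH]; first by rewrite stopped_by0.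
by rewrite !(ge0_integral_stopped_byS tauF)// leeD.
Qed.

End optimality.

Section stopping_times.
Context d d' (T : measurableType d) (Omega : measurableType d') (R : realType).
Variable X : nat -> {mfun Omega >-> T}.

Lemma stopping_time_cst n : stopping_time X (fun=> Some n).
Proof.
move=> k; apply/natural_filtrationP; have [nk|kn] := leqP n k.
  by exists setT => //; apply/seteqP; split => w //= _; exists n.
exists set0; rewrite ?preimage_set0//; apply/seteqP; split => w //= [i [<-]].
by rewrite leqNgt kn.
Qed.

(** The minimum of [tau] and [n], with [None] read as +oo. It is finite under every law, in
    particular under [Qt], where [tau] need not be, and agrees with [tau] on [{tau <= n}]. *)
Definition capped (tau : Omega -> option nat) (n : nat) (w : Omega) : option nat :=
  if tau w is Some k then Some (minn k n) else Some n.

Lemma stopping_time_capped tau n : stopping_time X tau ->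
  stopping_time X (capped tau n).
Proof.
move=> tauF k; have [nk|kn] := leqP n k.
  apply/natural_filtrationP; exists setT => //; apply/seteqP; split => w //= _.
  rewrite /capped; case: (tau w) => [i|]; last by exists n.
  by exists (minn i n) => //; rewrite geq_min nk orbT.
rewrite (_ : [set w | _] = [set w | exists2 i, tau w = Some i & (i <= k)%N]);
  first exact: tauF.
apply/seteqP; split => w /=; rewrite /capped; case: (tau w) => [i|].
- move=> [j [<-]]; rewrite geq_min leqNgt [(n <= k)%N]leqNgt kn orbF -leqNgt => ik.
  by exists i.
- by move=> [j [<-]]; rewrite leqNgt kn.
- move=> [j [<-] ik]; exists (minn i n) => //; by rewrite geq_min ik.
- by move=> [].
Qed.

Lemma integral_stopped_capped_le (Pr : probability Omega R)
    (g : nat -> Omega -> R) tau n :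
  stopping_time X tau -> (forall n, measurable_fun setT (g n)) ->
  (forall n w, 0 <= g n w) ->
  (\int[Pr]_(w in stopped_by tau n) (stopped g tau w)%:E <=
   \int[Pr]_w (stopped g (capped tau n) w)%:E)%E.
Proof.
move=> tauF mg g0; have mS := measurable_stopped_by tauF n.
have sg0 t w : 0 <= stopped g t w by rewrite /stopped; case: (t w).
have msg := measurable_stopped (stopping_time_capped n tauF) mg.
apply: (@le_trans _ _ (\int[Pr]_(w in stopped_by tau n) (stopped g (capped tau n) w)%:E)%E).
  rewrite le_eqVlt; apply/predU1P; left; apply: eq_integral => w.
  rewrite inE => -[k tw kn]; rewrite /stopped /capped tw.
  by rewrite (minn_idPl kn).
apply: ge0_subset_integral => //; first exact/measurable_EFinP.
by move=> w _; rewrite lee_fin.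
Qed.

End stopping_times.

(** * Numeraires and projections for i.i.d. samples *)

Section numeraire_iid.
Context d (T : measurableType d) (R : realType).
Variables (C : set (probability T R)) (Q Qt : probability T R) (E : T -> R).
Hypothesis CQt : C Qt.
Hypothesis CE : evalue C E.
Hypothesis QE : is_RN_derivative Q Qt E.
Variable Qa : {finite_measure set T -> \bar R}.
Hypothesis QaQt : is_ac_part Q Qt Qa.

Let mE : measurable_fun setT E. Proof. by have [] := CE. Qed.
Let E0 : forall x, 0 <= E x. Proof. by have [] := CE. Qed.

Lemma is_numeraire_ac_part : is_numeraire C Q E.
Proof.
apply: (is_numeraire_of_RN (P := Qa)) => //.
- exact: RN_pos_ae QE.
- exact: ac_part_inv QE QaQt.
- move=> f [mf f0 f1]; apply: le_trans (f1 _ CQt).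
  exact: ac_part_integral_le QaQt mf f0.
Qed.

Lemma is_RN_derivative_mpower_inv n :
  is_RN_derivative (mpower Qa n) (ppower Q n)
    (fun x : n.-tuple T => (\prod_(i < n) E (tnth x i))^-1).
Proof.
have := is_RN_derivative_mpower n (ac_part_inv QE QaQt).
by congr is_RN_derivative; apply/funext => x; rewrite prodfV.
Qed.

(** The criterion of [is_numeraire_of_RN] with the power of [Qa]: an e-value is tested at the single
    member [ppower Qt n] of the class, and the power of [Qa] lies below it. *)
Lemma is_numeraire_iid n : is_numeraire (iid_class C n) (ppower Q n)
  (fun x : n.-tuple T => \prod_(i < n) E (tnth x i)).
Proof.
have mH : measurable_fun setT (fun x : n.-tuple T => \prod_(i < n) E (tnth x i)).
  exact: measurable_prod_tnth.
apply: (is_numeraire_of_RN (P := mpower Qa n)).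
- split => // [x|_ [P CP <-]]; first exact: prodr_ge0.
  by apply: integral_prod_mpower_le1 => //; have [_ _] := CE; apply.
- exact: RN_pos_ae (is_RN_derivative_mpower n QE).
- exact: is_RN_derivative_mpower_inv.
- move=> f [mf f0 f1].
  have : (\int[ppower Qt n]_x (f x)%:E <= 1)%E by apply: f1; exists Qt.
  apply: le_trans.
  have RN := is_RN_derivative_mpower n (ac_part_indic QE QaQt).
  have [mN N0 _] := RN.
  rewrite (RN_change_of_variables RN)//; apply: ge0_le_integral => //.
  + by move=> x _; rewrite lee_fin mulr_ge0.
  + by apply/measurable_EFinP; exact: measurable_funM.
  + exact/measurable_EFinP.
  + move=> x _; rewrite lee_fin -[leRHS]mulr1 ler_wpM2l//; apply: prodr_ile1 => i _.
    by rewrite indicE; case: (_ \in _); rewrite lexx ler01.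
Qed.

Section sequential.
Context d' (Omega : measurableType d') (X : nat -> {mfun Omega >-> T}).
Variable IP : probability T R -> probability Omega R.
Hypothesis model : iid_model X IP (C `|` [set Q]).
Let M n w := \prod_(i < n) E (X i w).

Let iidC P : C P -> iid_under X (IP P) P.
Proof. by move=> CP; apply: model; left. Qed.

Let iidQ : iid_under X (IP Q) Q.
Proof. by apply: model; right. Qed.

Let M0 n w : 0 <= M n w. Proof. exact: prodr_ge0. Qed.

Let M_supermartingale P : C P -> supermartingale X (IP P) M.
Proof.
move=> CP; apply: (supermartingale_prod mE E0 (iidC CP)).
by have [_ _] := CE; apply.
Qed.

Lemma class_supermartingale_prod : class_supermartingale X IP C M.
Proof. by split => // w; rewrite /M big_ord0. Qed.

(** Optional stopping for unbounded times: by nonnegativity the bound on each [{tau <= n}] passes to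
    the limit. *)
Lemma eprocess_of_class_supermartingale g :
  class_supermartingale X IP C g -> adapted X g -> eprocess X IP C g.
Proof.
move=> [g0 g01 gs] ga; split => // P tau CP tauF _.
have mg n : measurable_fun setT (g n) by exact: measurable_wrt_fun (@ga n).
apply: (@integral_exhaustion_le _ _ _ _ _ (stopped_by tau)).
- by move=> n; exact: measurable_stopped_by tauF n.
- exact: nondecreasing_stopped_by.
- by have := measurable_stopped tauF mg.
- by move=> w; rewrite /stopped; case: (tau w).
- exact: stopped_out.
- move=> n; apply: (supermartingale_stopped_le tauF g0); first exact: gs.
  apply: (@le_trans _ _ (\int[IP P]_w 1)%E).
    apply: ge0_le_integral => //; do ?[by move=> w _; rewrite lee_fin].
    exact/measurable_EFinP.
  by rewrite integral_cst// mul1e probability_le1.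
Qed.

Lemma eprocess_Elog_ratio g tau : eprocess X IP C g -> stopping_time X tau ->
  Elog_ratio_le0 (IP Q) (stopped g tau) (stopped M tau).
Proof.
move=> [g0 ga g1] tauF.
have mg n : measurable_fun setT (g n) by exact: measurable_wrt_fun (@ga n).
apply: (Elog_ratio_stopped mE E0 (ac_part_inv QE QaQt) (ac_part_indic QE QaQt)
  iidQ (iidC CQt) g0 ga tauF) => n.
apply: (le_trans (integral_stopped_capped_le _ _ tauF mg g0)).
apply: g1 => //; first exact: stopping_time_capped.
by apply: aeW => w; rewrite /capped; case: (tau w).
Qed.

End sequential.
End numeraire_iid.

Theorem theorem4p10 (R : realType)
    (Q Qt : probability (measurableTypeR R) R)
    (hQ : on_halfline Q)
    (hQU : dominated_by_class Q (U0p R))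
    (hQt : is_least_concave_majorant Q Qt) :
  [/\ Q `<< Qt,
      (forall E : R -> R, is_dQdQt Q Qt E -> U1 R E) &
      forall Qa : {finite_measure set (measurableTypeR R) -> \bar R},
      is_ac_part Q Qt Qa ->
      [/\ is_RIPr (U0p R) Q Qa,
          (forall E : R -> R, is_dQdQt Q Qt E ->
             [/\ is_RN_derivative Q Qa E,
                 (forall Ea : R -> R, is_RN_derivative Q Qa Ea ->
                    {ae Q, forall x, E x = Ea x}) &
                 is_numeraire (U0p R) Q E]),
          (forall n : nat,
             is_RIPr (iid_class (U0p R) n) (ppower Q n) (mpower Qa n)),
          (forall E : R -> R, is_dQdQt Q Qt E -> forall n : nat,
             is_numeraire (iid_class (U0p R) n) (ppower Q n)
               (fun x : n.-tuple (measurableTypeR R) =>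
                  \prod_(i < n) E (tnth x i))) &
          (forall E : R -> R, is_dQdQt Q Qt E ->
           forall (d : measure_display) (Omega : measurableType d)
             (X : nat -> {mfun Omega >-> measurableTypeR R})
             (IP : probability (measurableTypeR R) R -> probability Omega R),
           iid_model X IP (U0p R `|` [set Q]) ->
           let M := fun (n : nat) (w : Omega) => \prod_(i < n) E (X i w) in
           [/\ class_supermartingale X IP (U0p R) M,
               (forall g, class_supermartingale X IP (U0p R) g ->
                  forall n, Elog_ratio_le0 (IP Q) (g n) (M n)),
               eprocess X IP (U0p R) M,
               (forall g, eprocess X IP (U0p R) g ->
                  forall n, Elog_ratio_le0 (IP Q) (g n) (M n)) &
               (forall tau, stopping_time X tau -> finite_under (IP Q) tau ->
                  forall g, eprocess X IP (U0p R) g ->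
                  Elog_ratio_le0 (IP Q) (stopped g tau) (stopped M tau))])]].
Proof.
have version := slope_version_of_is_dQdQt hQ hQU hQt.
have version_U1 E : slope_version Q Qt E -> U1 R E by exact: slope_version_U1.
have UQt : U0p R Qt by have [] := hQt.
have version_evalue E : slope_version Q Qt E -> evalue (U0p R) E.
  by move=> vE; have [[mE E0 _] _ _] := vE; apply: U1_evalue => //; exact: version_U1.
split=> [|E /version|Qa QaQt];
  [exact: majorant_dominates hQ hQU hQt|exact: version_U1|].
have [E' vE'] := slope_version_exists hQ hQU hQt.
have UE' := version_evalue _ vE'; have [QE' _ _] := vE'.
split.
- exists E'; split; first exact: (is_numeraire_ac_part UQt UE' QE' QaQt).
  exact: ac_part_inv QE' QaQt.
- move=> E /version vE; have UE := version_evalue _ vE; have [QE _ _] := vE.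
  have QaE := ac_part_RN QE QaQt; split => //.
  + by move=> Ea; exact: RN_unique QaE.
  + exact: (is_numeraire_ac_part UQt UE QE QaQt).
- move=> n; exists (fun x : n.-tuple (measurableTypeR R) => \prod_(i < n) E' (tnth x i)).
  split; first exact: (is_numeraire_iid UQt UE' QE' QaQt).
  exact: (is_RN_derivative_mpower_inv QE' QaQt).
- move=> E /version vE n; have UE := version_evalue _ vE; have [QE _ _] := vE.
  exact: (is_numeraire_iid UQt UE QE QaQt).
- move=> E /version vE d Omega X IP model M.
  have UE := version_evalue _ vE; have [QE _ _] := vE; have [mE _ _] := QE.
  have sM : class_supermartingale X IP (U0p R) M.
    by have := class_supermartingale_prod UE model.
  have log_opt g tau : eprocess X IP (U0p R) g -> stopping_time X tau ->
      Elog_ratio_le0 (IP Q) (stopped g tau) (stopped M tau).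
    exact: (eprocess_Elog_ratio UQt UE QE QaQt model).
  split => //.
  (* Such a supermartingale is an e-process, adaptedness being read off under the law [Qt]; a fixed
     sample size is the constant stopping time. *)
  + move=> g sg n; have [_ _ /(_ _ UQt)[ga _ _]] := sg.
    have eg := eprocess_of_class_supermartingale sg ga.
    by apply: (log_opt g (fun=> Some n) eg); exact: stopping_time_cst.
  + by apply: eprocess_of_class_supermartingale => //; exact: adapted_prod.
  + by move=> g eg n; apply: (log_opt g (fun=> Some n) eg); exact: stopping_time_cst.
  + by move=> tau tauF _ g eg; exact: log_opt.
Qed.
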